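(* Let $m\ge 1$, let $\mathcal{R}$ be a contractive quasi-free Hilbert module over $A(\mathbb{B}^m)$ of finite multiplicity $n$ ($1\le n<\infty$), and let $\{\varphi_1,\ldots,\varphi_k\}$ be a subset of $H^\infty(\mathbb{B}^m)\otimes M_n(\mathbb{C})$. If $(M_{\varphi_1},\ldots,M_{\varphi_k})$ is a semi-Fredholm tuple on $\mathcal{R}$, then there exist $\epsilon>0$ and $1>\delta>0$ such that $$\sum_{i=1}^{k}\varphi_i(z)\varphi_i(z)^*\ \ge\ \epsilon I_{\mathbb{C}^n}$$ for all $z\in\mathbb{B}^m$ satisfying $1>\|z\|\ge 1-\delta>0$. In particular, if the multiplicity of $\mathcal{R}$ is one, then $$\sum_{i=1}^{k}|\varphi_i(z)|^2\ge\epsilon$$ for all $z$ satisfying $1>\|z\|\ge 1-\delta$.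
   Context: All Hilbert spaces are separable and complex. $\mathbb{B}^m$ is the open unit ball of $\mathbb{C}^m$. For a domain $\Omega\subset\mathbb{C}^m$, $A(\Omega)$ is the uniform closure of the functions holomorphic on a neighborhood of the closure of $\Omega$, with the supremum norm. A bounded quasi-free Hilbert module of rank (multiplicity) $n$ over $A(\Omega)$, $1\le n\le\infty$, is a Hilbert space $\mathcal{R}$ obtained as the completion of the algebraic tensor product $A(\Omega)\otimes\ell^2_n$ (where $\ell^2_n$ is the $n$-dimensional Hilbert space, $=\mathbb{C}^n$ for $n<\infty$) relative to an inner product such that: (1) the evaluation $\mathrm{eval}_z\colon A(\Omega)\otimes\ell^2_n\to\ell^2_n$ is bounded for each $z\in\Omega$ and locally uniformly bounded on $\Omega$; (2) there is $C\ge 1$ with $\|\varphi(\sum\theta_i\otimes x_i)\|_{\mathcal{R}}=\|\sum\varphi\theta_i\otimes x_i\|_{\mathcal{R}}\le C\|\varphi\|_{A(\Omega)}\|\sum\theta_i\otimes x_i\|_{\mathcal{R}}$ for all $\varphi,\theta_i\in A(\Omega)$ and $x_i\in\ell^2_n$; (3) for every sequence $\{F_i\}$ in $A(\Omega)\otimes\ell^2_n$ that is Cauchy in the $\mathcal{R}$-norm, $\mathrm{eval}_z(F_i)\to 0$ for all $z\in\Omega$ if and only if $\|F_i\|_{\mathcal{R}}\to 0$. It is contractive if one can take $C=1$ in (2). Via the evaluations, $\mathcal{R}$ is identified with a reproducing kernel Hilbert space of holomorphic $\ell^2_n$-valued functions on $\Omega$. $H^\infty(\mathbb{B}^m)$ is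 the algebra of bounded holomorphic functions on $\mathbb{B}^m$, and $H^\infty(\mathbb{B}^m)\otimes M_n(\mathbb{C})$ is the algebra of bounded holomorphic $n\times n$ matrix-valued functions. Standing assumption: for $\mathcal{R}$ of finite multiplicity $n$, the multiplier space of $\mathcal{R}$ is precisely $H^\infty(\mathbb{B}^m)\otimes M_n(\mathbb{C})$; thus each $\varphi\in H^\infty(\mathbb{B}^m)\otimes M_n(\mathbb{C})$ defines a bounded operator $M_\varphi$ on $\mathcal{R}$, $(M_\varphi f)(z)=\varphi(z)f(z)$. The tuple $(M_{\varphi_1},\ldots,M_{\varphi_k})$ is semi-Fredholm if the range of the row operator $(M_{\varphi_1},\ldots,M_{\varphi_k})\colon\mathcal{R}^k\to\mathcal{R}$, $(f_1,\dots,f_k)\mapsto\sum_i M_{\varphi_i}f_i$, has finite codimension, i.e. $\dim[\mathcal{R}/(M_{\varphi_1}\mathcal{R}+\cdots+M_{\varphi_k}\mathcal{R})]<\infty$. *)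

(* Defs.v *)
From HB Require Import structures.
From mathcomp Require Import all_boot all_order all_algebra.
From mathcomp Require Import complex.
From mathcomp Require Import all_classical all_reals all_analysis.

Set Implicit Arguments.
Unset Strict Implicit.
Unset Printing Implicit Defensive.

Import Order.TTheory GRing.Theory Num.Theory Num.Def.
Import numFieldNormedType.Exports.

Local Open Scope classical_set_scope.
Local Open Scope sesquilinear_scope.
Local Open Scope ring_scope.

(* The definitions below make sense over any [C : numClosedFieldType] (whose
   norm, topology and partial order are those of complex numbers: [x <= y]
   means that [y - x] is a nonnegative real); they are meant to be used with
   [C := Cplx R]. *)
Definition Cplx (R : realType) : numClosedFieldType := R[i].

Section EuclideanSpace.
Context {C : numClosedFieldType}.

(* The canonical norm on matrices is the sup norm; the Euclidean norm on C^n
   has to be defined separately.  Both induce the same topology. *)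
Definition l2norm n (v : 'cV[C]_n) : C := sqrtC (\sum_i `|v i 0| ^+ 2).

Definition unit_ball m : set 'cV[C]_m := [set z | l2norm z < 1].

(* A >= B in the Loewner order. *)
Definition mx_ge n (A B : 'M[C]_n) : Prop :=
  forall x : 'cV[C]_n, 0 <= (x ^t* *m (A - B) *m x) 0 0.

End EuclideanSpace.
Arguments unit_ball {C} m.

Section FunctionAlgebras.
Context {C : numClosedFieldType} {m : nat}.
Implicit Types (Omega U : set 'cV[C]_m).

(* [differentiable] is Frechet differentiability over the field C. *)
Definition holomorphic_on U (f : 'cV[C]_m -> C) : Prop :=
  forall z, U z -> differentiable f z.

(* Functions on Omega are represented by total functions, whose values
   outside Omega are irrelevant. *)
Definition supnorm Omega (f : 'cV[C]_m -> C) : C :=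
  supremum 0 [set `|f z| | z in Omega].

(* A(Omega). *)
Definition A_alg Omega : set ('cV[C]_m -> C) :=
  [set f | forall e : C, 0 < e -> exists U g,
    [/\ open U, closure Omega `<=` U, holomorphic_on U g
      & forall z, Omega z -> `|f z - g z| <= e]].

(* A(Omega) (x) C^n, where theta (x) x is the function z |-> theta(z) x. *)
Definition A_tensor Omega n : set ('cV[C]_m -> 'cV[C]_n) :=
  [set F | forall i, A_alg Omega (fun z => F z i 0)].

Definition Hinf Omega : set ('cV[C]_m -> C) :=
  [set f | holomorphic_on Omega f /\
           exists c : C, forall z, Omega z -> `|f z| <= c].

(* H^oo(Omega) (x) M_n(C). *)
Definition Hinf_mx Omega n : set ('cV[C]_m -> 'M[C]_n) :=
  [set phi | forall i j, Hinf Omega (fun z => phi z i j)].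

End FunctionAlgebras.
Arguments A_tensor {C m} Omega n.
Arguments Hinf_mx {C m} Omega n.

Record hilbertSpace (C : numClosedFieldType) := HilbertSpace {
  hilbert_sort :> completeNormedModType C;
  hilbert_dot : {dot hilbert_sort for conjC};
  hilbert_normE : forall x, `|x| ^+ 2 = hilbert_dot x x;
  hilbert_separable : exists2 D : set hilbert_sort, countable D & dense D
}.

Section QuasiFree.
Context {C : numClosedFieldType} {m n : nat}.
Variables (Omega : set 'cV[C]_m) (H : hilbertSpace C).
(* The canonical map from A(Omega) (x) C^n to its completion H; it is only
   relevant on [A_tensor Omega n]. *)
Variable iota : ('cV[C]_m -> 'cV[C]_n) -> H.

Definition module_bound (c : C) : Prop :=
  forall phi F, A_alg Omega phi -> A_tensor Omega n F ->
    `|iota (fun z => phi z *: F z)| <= c * supnorm Omega phi * `|iota F|.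

(* H is the completion of A(Omega) (x) C^n for the inner product
   (F, G) |-> hilbert_dot (iota F) (iota G), and is a bounded quasi-free
   Hilbert module of rank n over A(Omega).  By [qf_iota_eq], iota is well
   defined and injective on functions on Omega, i.e. the inner product is
   well defined and positive definite. *)
Record quasi_free : Prop := QuasiFree {
  qf_iota_eq : forall F G, A_tensor Omega n F -> A_tensor Omega n G ->
    iota F = iota G <-> (forall z, Omega z -> F z = G z);
  qf_iota_linear : forall (a : C) F G,
    A_tensor Omega n F -> A_tensor Omega n G ->
    iota (fun z => a *: F z + G z) = a *: iota F + iota G;
  qf_iota_dense : dense (iota @` A_tensor Omega n);
  qf_eval_bounded : forall z, Omega z ->
    exists c : C, forall F, A_tensor Omega n F ->
      l2norm (F z) <= c * `|iota F|;
  qf_eval_locally_bounded : forall z0, Omega z0 ->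
    exists c : C, \forall z \near z0, Omega z ->
      forall F, A_tensor Omega n F -> l2norm (F z) <= c * `|iota F|;
  qf_module_bounded : exists2 c : C, 1 <= c & module_bound c;
  qf_cauchy : forall F : nat -> 'cV[C]_m -> 'cV[C]_n,
    (forall j, A_tensor Omega n (F j)) ->
    cauchy ((fun j => iota (F j)) @ \oo) ->
    (forall z, Omega z -> (fun j => F j z) @ \oo --> (0 : 'cV[C]_n)) <->
    (fun j => `|iota (F j)|) @ \oo --> (0 : C)
}.

Definition contractive : Prop := module_bound 1.

(* The value f(z) of f in H: the extension by continuity of the evaluation
   at z from A(Omega) (x) C^n to its completion. *)
Definition qf_eval (f : H) (z : 'cV[C]_m) : 'cV[C]_n :=
  get [set w | forall F : nat -> 'cV[C]_m -> 'cV[C]_n,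
    (forall j, A_tensor Omega n (F j)) ->
    (fun j => iota (F j)) @ \oo --> f ->
    (fun j => F j z) @ \oo --> w].

Definition multiplier_space : set ('cV[C]_m -> 'M[C]_n) :=
  [set phi | exists T : {linear H -> H}, continuous T /\
    forall f z, Omega z -> qf_eval (T f) z = phi z *m qf_eval f z].

(* M_phi; since f is determined by its values on Omega, the specification
   below has at most one solution, and it has one if phi is a multiplier. *)
Definition mult_op (phi : 'cV[C]_m -> 'M[C]_n) (f : H) : H :=
  get [set g | forall z, Omega z -> qf_eval g z = phi z *m qf_eval f z].

End QuasiFree.

Section SemiFredholm.
Context {C : numClosedFieldType} {V : lmodType C}.

(* dim (V / W) < oo: the classes of finitely many vectors span V / W. *)
Definition finite_codim (W : set V) : Prop :=
  exists (d : nat) (v : 'I_d -> V), forall h,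
    exists c : 'I_d -> C, W (h - \sum_i c i *: v i).

Definition row_range k (T : 'I_k -> V -> V) : set V :=
  [set \sum_i T i (f i) | f in [set: 'I_k -> V]].

Definition semi_fredholm k (T : 'I_k -> V -> V) : Prop :=
  finite_codim (row_range T).

End SemiFredholm.

(* Main.v *)
Require Import Defs.
From mathcomp Require Import all_boot all_order all_algebra.
From mathcomp Require Import complex.
From mathcomp Require Import all_classical all_reals all_analysis.
From mathcomp Require Import ring lra.
Import Order.TTheory GRing.Theory Num.Theory.
Import numFieldNormedType.Exports.
Local Open Scope classical_set_scope.
Local Open Scope sesquilinear_scope.
Local Open Scope ring_scope.
Local Open Scope complex_scope.

Set Implicit Arguments.
Unset Strict Implicit.
Unset Printing Implicit Defensive.

(* Let N(z) be the norm of the evaluation f |-> f(z).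
   First, N(z) -> oo at the boundary: for a boundary point w, powers of
   the peak function (1 + <u, w>) / 2 have convex combinations (in fact, close
   substitutes for them) that equal 1 at w but are small in the module norm, and
   compactness of the sphere makes the resulting lower bound for N uniform.
   Hence |<v(z), x>| / N(z) -> 0 for every fixed v in the module, since v is
   approximated by functions that are bounded on the ball.
   Secondly, let v_1, ..., v_d span a complement of the range of the row
   operator.  Dividing f |-> <f(z), x> by N(z) times
   max(|phi_i(z)^* x|, |<v_j(z), x>| / N(z)) gives a family of functionals that
   is pointwise bounded, because every f is a sum of some M_{phi_i} g_i and a
   combination of the v_j.  By uniform boundedness, and because constant
   matrices are multipliers, that maximum is at least c |x|.  Near the boundary
   the terms with v_j are smaller than that, so max_i |phi_i(z)^* x| >= c |x|. *)

(** * Real-valued norms *)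

Section RealNorm.
Context {R : realType}.
Local Notation C := (Cplx R).

(** Norms over [Cplx R] take their values in [Cplx R], which is only partially ordered. Their real
    parts live in [R], where the order is total and [lra] applies. *)
Definition nr (V : normedZmodType C) (x : V) : R := complex.Re `|x|.

Lemma nrE (V : normedZmodType C) (x : V) : (nr x)%:C = `|x| :> C.
Proof. by rewrite /nr RRe_real // ger0_real. Qed.

Lemma ler_Cplx (a b : R) : ((a%:C : C) <= b%:C) = (a <= b).
Proof. exact: lecR. Qed.

Lemma ltr_Cplx (a b : R) : ((a%:C : C) < b%:C) = (a < b).
Proof. exact: ltcR. Qed.

Lemma nr_ge0 (V : normedZmodType C) (x : V) : 0 <= nr x.
Proof. by rewrite -ler_Cplx nrE normr_ge0. Qed.

Lemma nr0 (V : normedZmodType C) : nr (0 : V) = 0.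
Proof. by rewrite /nr normr0. Qed.

Lemma nrN (V : normedZmodType C) (x : V) : nr (- x) = nr x.
Proof. by rewrite /nr normrN. Qed.

Lemma nrBC (V : normedZmodType C) (x y : V) : nr (x - y) = nr (y - x).
Proof. by rewrite -nrN opprB. Qed.

Lemma nr_triangle (V : normedZmodType C) (x y : V) : nr (x + y) <= nr x + nr y.
Proof. by rewrite -ler_Cplx rmorphD /= !nrE ler_normD. Qed.

Lemma nr_triangleB (V : normedZmodType C) (x y : V) : nr (x - y) <= nr x + nr y.
Proof. by rewrite -(nrN y) nr_triangle. Qed.

Lemma nr_dist_triangle (V : normedZmodType C) (y x z : V) :
  nr (x - z) <= nr (x - y) + nr (y - z).
Proof. by have := nr_triangle (x - y) (y - z); rewrite addrA subrK. Qed.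

Lemma nr_sum (V : normedZmodType C) (I : finType) (F : I -> V) :
  nr (\sum_i F i) <= \sum_i nr (F i).
Proof.
elim/big_ind2 : _ => [|x1 x2 y1 y2 h1 h2|//]; first by rewrite nr0.
by apply: le_trans (nr_triangle _ _) _; exact: lerD.
Qed.

Lemma nr_le_normE (V W : normedZmodType C) (x : V) (y : W) :
  (`|x| <= `|y| :> C) = (nr x <= nr y).
Proof. by rewrite -!nrE ler_Cplx. Qed.

Lemma nrM (x y : C) : nr (x * y) = nr x * nr y.
Proof. by apply: complexI; rewrite rmorphM /= !nrE normrM. Qed.

Lemma nrX (x : C) k : nr (x ^+ k) = nr x ^+ k.
Proof. by apply: complexI; rewrite rmorphXn /= !nrE normrX. Qed.

Lemma nrV (x : C) : nr (x^-1) = (nr x)^-1.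
Proof. by apply: complexI; rewrite fmorphV /= !nrE normfV. Qed.

Lemma nr_real (a : R) : nr (a%:C : C) = `|a|.
Proof.
apply: complexI; rewrite nrE normc_def /=.
by rewrite expr0n /= addr0 sqrtr_sqr.
Qed.

Lemma nr1 : nr (1 : C) = 1.
Proof. by rewrite /nr normr1. Qed.

Lemma nr_eq0 (V : normedZmodType C) (x : V) : (nr x == 0) = (x == 0).
Proof. by rewrite -[RHS]normr_eq0 -nrE -(inj_eq (@complexI R)). Qed.

Lemma nr_conj (x : C) : nr (Num.conj x) = nr x.
Proof. by rewrite /nr norm_conjC. Qed.

Lemma nrZ (V : normedModType C) (a : C) (x : V) : nr (a *: x) = nr a * nr x.
Proof. by apply: complexI; rewrite rmorphM /= !nrE normrZ. Qed.

Lemma Re_le_nr (x : C) : `|complex.Re x| <= nr x.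
Proof.
rewrite -(@ler_Cplx `|_|) nrE normc_def ler_Cplx -sqrtr_sqr.
by rewrite ler_wsqrtr // lerDl sqr_ge0.
Qed.

Lemma Im_le_nr (x : C) : `|complex.Im x| <= nr x.
Proof.
rewrite -(@ler_Cplx `|_|) nrE normc_def ler_Cplx -sqrtr_sqr.
by rewrite ler_wsqrtr // lerDr sqr_ge0.
Qed.

Lemma nr_le_ReIm (x : C) : nr x <= `|complex.Re x| + `|complex.Im x|.
Proof.
have hi : nr ('i%C : C) = 1.
  apply: complexI; rewrite nrE normc_def /=.
  by rewrite expr0n /= add0r expr1n sqrtr1.
rewrite {1}[x]complexE (le_trans (nr_triangle _ _)) //.
by rewrite nrM hi mul1r !nr_real.
Qed.

Lemma gt0_complexP (e : C) : 0 < e -> exists2 e' : R, 0 < e' & e = e'%:C.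
Proof.
move=> e0; exists (complex.Re e); last by rewrite RRe_real // gtr0_real.
by rewrite -ltr_Cplx RRe_real // gtr0_real.
Qed.

Lemma norm_lt_nr (V : normedZmodType C) (x : V) (e : R) :
  (`|x| < e%:C :> C) = (nr x < e).
Proof. by rewrite -nrE ltr_Cplx. Qed.

Lemma norm_le_nr (V : normedZmodType C) (x : V) (e : R) :
  (`|x| <= e%:C :> C) = (nr x <= e).
Proof. by rewrite -nrE ler_Cplx. Qed.

Lemma ex_natSinv_lt (e : R) : 0 < e -> exists N : nat, N.+1%:R^-1 < e.
Proof.
move=> e0; exists (Num.bound e^-1); rewrite invf_plt ?posrE //.
apply: lt_trans (archi_boundP _) _; first by rewrite invr_ge0 ltW.
by rewrite ltr_nat.
Qed.

Lemma cvg_nrP (V : normedModType C) (u : nat -> V) (l : V) :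
  u @ \oo --> l <->
  forall e : R, 0 < e -> exists N, forall j, (N <= j)%N -> nr (u j - l) < e.
Proof.
split=> [ul e e0|H].
  have e0' : 0 < (e%:C : C) by rewrite ltr_Cplx.
  move/cvgrPdist_lt: ul => /(_ _ e0') [N _ HN].
  by exists N => j Nj; rewrite nrBC -norm_lt_nr; exact: HN.
apply/cvgrPdist_lt => e /gt0_complexP [e' e0 ->].
have [N HN] := H _ e0; exists N => // j Nj /=.
by rewrite norm_lt_nr nrBC; exact: HN.
Qed.

Lemma cauchy_nrP (V : normedModType C) (u : nat -> V) :
  cauchy (u @ \oo) <->
  forall e : R, 0 < e -> exists N, forall j k, (N <= j)%N -> (N <= k)%N ->
    nr (u j - u k) < e.
Proof.
split=> [/cauchy_ballP uc e e0|H].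
  have e0' : 0 < (e%:C : C) by rewrite ltr_Cplx.
  have := uc _ e0'; rewrite near_simpl => -[[A B] /= [[N1 _ h1] [N2 _ h2]] AB].
  exists (maxn N1 N2) => j k; rewrite !geq_max => /andP[j1 j2] /andP[k1 k2].
  have := AB (j, k) (conj (h1 _ j1) (h2 _ k2)) => /=.
  by rewrite -ball_normE /= norm_lt_nr.
apply/cauchy_ballP => e /gt0_complexP [e' e0 ->]; near_simpl.
have [N HN] := H _ e0.
exists ([set j | (N <= j)%N], [set j | (N <= j)%N]) => /=.
  by split; exists N.
move=> [j k] /= [Nj Nk]; rewrite -ball_normE /= norm_lt_nr; exact: HN.
Qed.

Lemma complete_nr (V : completeNormedModType C) (u : nat -> V) :
  (forall e : R, 0 < e -> exists N, forall j k, (N <= j)%N -> (N <= k)%N ->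
    nr (u j - u k) < e) -> exists l : V, u @ \oo --> l.
Proof. by move=> H; apply/cvg_ex/cauchy_cvgP/cauchy_nrP. Qed.

Lemma complete_real (u : nat -> R) :
  (forall e : R, 0 < e -> exists N, forall j k, (N <= j)%N -> (N <= k)%N ->
    `|u j - u k| < e) -> exists l : R, u @ \oo --> l.
Proof.
move=> H; apply/cvg_ex/cauchy_cvgP/cauchy_ballP => e e0; near_simpl.
have [N HN] := H _ e0.
exists ([set j | (N <= j)%N], [set j | (N <= j)%N]) => /=.
  by split; exists N.
move=> [j k] /= [Nj Nk]; rewrite -ball_normE /=; exact: HN.
Qed.

Lemma complete_complex (u : nat -> C) :
  (forall e : R, 0 < e -> exists N, forall j k, (N <= j)%N -> (N <= k)%N ->
    nr (u j - u k) < e) -> exists l : C, u @ \oo --> l.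
Proof.
move=> H.
have [a ua] : exists a : R, (fun j => complex.Re (u j) : R) @ \oo --> a.
  apply: complete_real => e /H [N HN]; exists N => j k Nj Nk.
  by apply: le_lt_trans (HN _ _ Nj Nk); rewrite -raddfB; exact: Re_le_nr.
have [b ub] : exists b : R, (fun j => complex.Im (u j) : R) @ \oo --> b.
  apply: complete_real => e /H [N HN]; exists N => j k Nj Nk.
  by apply: le_lt_trans (HN _ _ Nj Nk); rewrite -raddfB; exact: Im_le_nr.
exists (a +i* b : C); apply/cvg_nrP => e e0.
have e2 : 0 < e / 2 by rewrite divr_gt0.
move/cvgrPdist_lt: ua => /(_ _ e2) [N1 _ h1].
move/cvgrPdist_lt: ub => /(_ _ e2) [N2 _ h2].
exists (maxn N1 N2) => j; rewrite geq_max => /andP[j1 j2].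
apply: le_lt_trans (nr_le_ReIm _) _.
have := h1 _ j1; have := h2 _ j2 => /=.
rewrite [in X in X -> _]distrC [in X in _ -> X -> _]distrC => q1 q2.
by rewrite [ltRHS]splitr ltrD //; move: q1 q2; case: (u j).
Qed.

Lemma nr_cvg_le (V : normedModType C) (u : nat -> V) l (c : R) :
  u @ \oo --> l -> (exists N, forall j, (N <= j)%N -> nr (u j) <= c) ->
  nr l <= c.
Proof.
move=> /cvg_nrP ul [N H]; apply/ler_addgt0Pr => e /ul [N' HN'].
pose j := maxn N N'.
have := nr_triangle (l - u j) (u j); rewrite subrK => h.
apply: le_trans h _; rewrite addrC lerD // ?H ?leq_maxl //.
by rewrite nrBC ltW // HN' // leq_maxr.
Qed.

Lemma cvg_linear_comb (V : normedModType C) (a : C) (u v : nat -> V) x y :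
  u @ \oo --> x -> v @ \oo --> y ->
  (fun j => a *: u j + v j) @ \oo --> a *: x + y.
Proof. by move=> ux vy; apply: cvgD vy; apply: cvgZr. Qed.

Lemma nr_mx_coord n (M : 'cV[C]_n) i : nr (M i 0) <= nr M.
Proof.
rewrite -nr_le_normE [leRHS]/Num.norm /= mx_normE.
exact: (@le_bigmax _ _ _ _ (fun i : 'I_n * 'I_1 => `|M i.1 i.2|%:nng) (i, 0)).
Qed.

Lemma nr_mx_lt n (M : 'cV[C]_n) (e : R) : 0 < e ->
  (forall i, nr (M i 0) < e) -> nr M < e.
Proof.
move=> e0 H; have [|] := eqVneq (mx_norm M) 0; rewrite -norm_lt_nr.
  by move=> h; rewrite [ltLHS]/Num.norm /= h ltr_Cplx.
move=> /mx_norm_neq0 [[i j] /= h].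
by rewrite [ltLHS]/Num.norm /= h ord1 norm_lt_nr.
Qed.

Lemma cvg_colP n (u : nat -> 'cV[C]_n) (l : 'cV[C]_n) :
  u @ \oo --> l <-> forall i, (fun j => u j i 0) @ \oo --> l i 0.
Proof.
split=> [/cvg_nrP ul i|H].
  apply/cvg_nrP => e /ul [N HN]; exists N => j /HN; apply: le_lt_trans.
  by have := nr_mx_coord (u j - l) i; rewrite !mxE.
apply/cvg_nrP => e e0.
have HN i : exists N, forall j, (N <= j)%N -> nr (u j i 0 - l i 0) < e.
  by move/cvg_nrP: (H i) => /(_ _ e0).
pose N i := projT1 (cid (HN i)).
exists (\max_i N i)%N => j Nj; apply: nr_mx_lt => // i; rewrite !mxE.
apply: (projT2 (cid (HN i))); apply: leq_trans Nj; exact: leq_bigmax.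
Qed.

End RealNorm.

(** * Uniform boundedness and compactness over the complex numbers *)

Section UniformBoundedness.
Context {R : realType}.
Local Notation C := (Cplx R).
Context {V : completeNormedModType C} {I : Type} (L : I -> V -> C).
Hypothesis L_add : forall i x y, L i (x + y) = L i x + L i y.
Hypothesis L_scale : forall i a x, L i (a *: x) = a * L i x.
Hypothesis L_bounded :
  forall i, exists c : R, forall x, nr (L i x) <= c * nr x.
Hypothesis L_pointwise :
  forall x, exists c : R, forall i, nr (L i x) <= c.

Let L_sub i x y : L i (x - y) = L i x - L i y.
Proof. by rewrite L_add -scaleN1r L_scale mulN1r. Qed.

(* [Banach_Steinhauss] only covers real scalar fields.  Were the family
   unbounded on every ball, one could nest balls on the [d]-th of which some
   member exceeds [d]; their common point contradicts pointwise boundedness. *)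
Lemma uniform_boundedness_shrink (x : V) (r : R) (d : nat) : 0 < r ->
  (forall x r (c : R), 0 < r ->
     exists y i, nr (y - x) <= r /\ c < nr (L i y)) ->
  exists p : V * R, [/\ 0 < p.2, p.2 <= r / 2,
    forall y, nr (y - p.1) <= p.2 -> nr (y - x) <= r
    & exists i, forall y, nr (y - p.1) <= p.2 -> d%:R < nr (L i y)].
Proof.
move=> r0 H; have r2 : 0 < r / 2 by rewrite divr_gt0.
have [y0 [i [y0x Ly0]]] := H x _ (d%:R + 1) r2.
have [c Lc] := L_bounded i.
pose K := `|c| + 1; have K0 : 0 < K by rewrite ltr_wpDl.
(* At [y0] the functional exceeds [d + 1]; within distance [K^-1] it changes by at most 1, so it
   stays above [d]. *)
exists (y0, Num.min (r / 2) K^-1) => /=; split.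
- by rewrite lt_min r2 invr_gt0.
- by rewrite ge_min lexx.
- move=> y; rewrite le_min => /andP[yr _].
  by rewrite [r]splitr (le_trans (nr_dist_triangle y0 _ _)) ?lerD.
exists i => y; rewrite le_min => /andP[_ yK].
have h1 : nr (L i (y0 - y)) <= 1.
  apply: le_trans (Lc _) _; rewrite nrBC.
  apply: (@le_trans _ _ (K * nr (y - y0))).
    by rewrite ler_wpM2r ?nr_ge0 // ler_wpDr // ler_norm.
  by rewrite -ler_pdivlMl // mulr1.
have := nr_triangle (L i (y0 - y)) (L i y); rewrite -L_add subrK => h2.
by lra.
Qed.

Lemma uniform_boundedness_ball :
  exists x r (c : R), 0 < r /\ forall y i, nr (y - x) <= r -> nr (L i y) <= c.
Proof.
apply: contrapT => /forallNP N.
have {}N x (r c : R) : 0 < r -> exists y i, nr (y - x) <= r /\ c < nr (L i y).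
  move=> r0; apply: contrapT => Nx; apply: (N x); exists r, c; split=> // y i yr.
  by rewrite leNgt; apply/negP => ly; apply: Nx; exists y, i.
(* Positivity of the old radius sits inside the existential, so that choice yields a total function
   [f] that can be iterated. *)
have step (d : nat) (q : V * R) : exists p : V * R, 0 < q.2 ->
    [/\ 0 < p.2, p.2 <= q.2 / 2,
    forall y, nr (y - p.1) <= p.2 -> nr (y - q.1) <= q.2
    & exists i, forall y, nr (y - p.1) <= p.2 -> d%:R < nr (L i y)].
  have [q0|q0] := boolP (0 < q.2); last by exists q.
  by have [p hp] := uniform_boundedness_shrink q.1 d q0 N; exists p.
pose f d q := projT1 (cid (step d q)).
have fP d q := projT2 (cid (step d q)).
pose fix s d : V * R := if d is d'.+1 then f d' (s d') else (0, 1).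
have s0 d : 0 < (s d).2 by elim: d => [//|d /(fP d) []].
have r_le d : (s d).2 <= 2^-1 ^+ d.
  elim: d => [|d IH]; first by rewrite expr0.
  have [_ + _ _] := fP d (s d) (s0 d); move/le_trans; apply.
  by rewrite exprSr ler_pM2r.
have nest j k y : nr (y - (s (k + j)%N).1) <= (s (k + j)%N).2 ->
    nr (y - (s j).1) <= (s j).2.
  elim: k => [//|k IH] h; apply: IH.
  by have [_ _ + _] := fP (k + j)%N (s (k + j)%N) (s0 _); apply.
have near j k : (j <= k)%N -> nr ((s k).1 - (s j).1) <= (s j).2.
  move=> jk; apply: (nest _ (k - j)%N); rewrite subnK // subrr nr0.
  exact: ltW.
have [l sl] : exists l : V, (fun d => (s d).1) @ \oo --> l.
  apply: complete_nr => e e0.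
  have e2 : 0 < e / 2 by rewrite divr_gt0.
  have [M HM] : exists M, 2^-1 ^+ M < e / 2.
    have h : (fun d => 2^-1 ^+ d : R) @ \oo --> (0 : R).
      by apply: cvg_expr; rewrite gtr0_norm ?invr_gt0 // invf_lt1 // ltr1n.
    move/cvgrPdist_lt: h => /(_ _ e2) [M _ /(_ M)] /= /(_ (leqnn _)).
    by rewrite sub0r normrN normrX ger0_norm ?invr_ge0 // => ?; exists M.
  exists M => j k Mj Mk.
  have h1 := near _ _ Mj; have h2 := near _ _ Mk; have h3 := le_lt_trans (r_le M) HM.
  have h4 := nr_dist_triangle (s M).1 (s j).1 (s k).1.
  by rewrite [nr ((s M).1 - _)]nrBC in h4; lra.
have lin j : nr (l - (s j).1) <= (s j).2.
  apply: (@nr_cvg_le _ _ (fun d => (s d).1 - (s j).1)).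
    by apply: cvgB sl _; exact: cvg_cst.
  by exists j => k; exact: near.
have [c cP] := L_pointwise l.
have [d dP] : exists d : nat, c < d%:R.
  by exists (Num.bound `|c|); exact: le_lt_trans (ler_norm _) (archi_boundP _).
(* Ball number [d.+1] is the one on which some functional exceeds [d], and [l] lies in all the
   balls. *)
have [_ _ _ [i /(_ l (lin d.+1))]] := fP d (s d) (s0 d).
by rewrite ltNge (le_trans (cP i)) // ltW.
Qed.

Lemma uniform_boundedness :
  exists c : R, forall i x, nr (L i x) <= c * nr x.
Proof.
have [x [r [c [r0 H]]]] := uniform_boundedness_ball.
(* [2 * c] bounds the difference of the values at [x + a *: v] and at [x], where [a] rescales [v] to
   norm [r]. *)
exists (2 * c / r) => i v.
have [->|v0] := eqVneq v 0.
  by rewrite -(scale0r 0) L_scale mul0r scale0r !nr0 mulr0.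
have nv : 0 < nr v by rewrite lt0r nr_eq0 v0 nr_ge0.
have h1 : nr (L i x) <= c by apply: H; rewrite subrr nr0 ltW.
pose a : C := (r / nr v)%:C.
have na : nr a = r / nr v by rewrite nr_real gtr0_norm ?divr_gt0.
have h2 : nr (L i (x + a *: v)) <= c.
  by apply: H; rewrite addrC addKr nrZ na divfK ?lexx // gt_eqF.
have := nr_triangleB (L i (x + a *: v)) (L i x).
rewrite -L_sub addrC addKr L_scale nrM na => h3.
have : r / nr v * nr (L i v) <= 2 * c by lra.
rewrite mulrAC ler_pdivrMr // => h4.
by rewrite [leRHS]mulrAC ler_pdivlMr // mulrC.
Qed.

End UniformBoundedness.

Section BolzanoWeierstrass.
Context {R : realType}.
Local Notation C := (Cplx R).

(** Real and imaginary parts give a sequence in the compact cube [-1, 1]^(2m), which has a cluster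
    point. Later arguments only ask for one late term close to [w], so no subsequence is
    extracted. *)
Lemma bolzano_weierstrass_complex m (u : nat -> 'cV[C]_m) :
  (forall j i, nr (u j i 0) <= 1) ->
  exists w : 'cV[C]_m, forall (e : R) N, 0 < e ->
    exists2 j, (N <= j)%N & forall i, nr (u j i 0 - w i 0) < e.
Proof.
move=> u1.
pose v j : 'rV[R]_(m + m) := row_mx (\row_i complex.Re (u j i 0))
                                    (\row_i complex.Im (u j i 0)).
have cK : compact [set x : 'rV[R]_(m + m) | forall i, x ord0 i \in `[-1, 1]].
  have := @rV_compact R (m + m) (fun=> [set` `[-1, 1 : R]]).
  apply => _; exact: segment_compact.
have [|x [_ clx]] := cK (v @ \oo) _.
  exists 0%N => // j _ i; rewrite in_itv /= -ler_norml mxE.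
  case: splitP => k _; rewrite mxE; apply: le_trans (u1 j k).
    exact: Re_le_nr.
  exact: Im_le_nr.
exists (\col_i (x 0 (lshift m i) +i* x 0 (rshift m i))) => e N e0.
have e2 : 0 < e / 2 by rewrite divr_gt0.
have [||_ /= [[j Nj <-] xvj]] :=
  clx (v @` [set j | (N <= j)%N]) (ball x (e / 2)).
- by exists N => // j Nj; exists j.
- exact: nbhsx_ballx.
exists j => // i; rewrite mxE.
case: xvj => _ xvj.
have h1 := xvj 0 (lshift m i); have h2 := xvj 0 (rshift m i).
move: h1 h2; rewrite /v row_mxEl row_mxEr !mxE -!ball_normE /= => h1 h2.
apply: le_lt_trans (nr_le_ReIm _) _; rewrite [ltRHS]splitr.
rewrite distrC in h1; rewrite distrC in h2.
by case: (u j i 0) h1 h2 => a b /= h1 h2; rewrite ltrD.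
Qed.

End BolzanoWeierstrass.

(** * Evaluation on a quasi-free module *)

Section EuclideanNorm.
Context {R : realType}.
Local Notation C := (Cplx R).

Lemma l2normE n (v : 'cV[C]_n) :
  l2norm v = (Num.sqrt (\sum_i nr (v i 0) ^+ 2))%:C.
Proof.
rewrite /l2norm; set s : R := \sum_i nr (v i 0) ^+ 2.
have -> : \sum_i `|v i 0| ^+ 2 = (Num.sqrt s)%:C ^+ 2 :> C.
  rewrite -rmorphXn /= sqr_sqrtr; last by rewrite sumr_ge0 // => i _; exact: sqr_ge0.
  by rewrite rmorph_sum /=; apply: eq_bigr => i _; rewrite rmorphXn /= nrE.
by rewrite sqrCK // ler0c sqrtr_ge0.
Qed.

Lemma l2norm_lt1 n (v : 'cV[C]_n) :
  (l2norm v < 1) = (\sum_i nr (v i 0) ^+ 2 < 1).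
Proof. by rewrite l2normE -[1]/((1:R)%:C) ltr_Cplx -{1}sqrtr1 ltr_sqrt. Qed.

Lemma nr_coord_l2norm n (v : 'cV[C]_n) i : `|v i 0| <= l2norm v.
Proof.
rewrite l2normE norm_le_nr -[leLHS]ger0_norm ?nr_ge0 // -sqrtr_sqr.
rewrite ler_wsqrtr // (bigD1 i) //= lerDl sumr_ge0 // => j _; exact: sqr_ge0.
Qed.

End EuclideanNorm.

(** * Linear structure of A(Omega) and of its vector-valued version *)

Section FunctionAlgebra.
Context {R : realType} {m : nat}.
Local Notation C := (Cplx R).
Implicit Types (Omega : set 'cV[C]_m) (f g : 'cV[C]_m -> C).

Lemma A_alg_linear Omega (a : C) f g : A_alg Omega f -> A_alg Omega g ->
  A_alg Omega (fun z => a * f z + g z).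
Proof.
move=> Af Ag e e0.
have e1 : 0 < e / 2 / (`|a| + 1) by rewrite !divr_gt0 // ltr_wpDl.
have e2 : 0 < e / 2 by rewrite divr_gt0.
have [U [f' [oU cU hf' ff']]] := Af _ e1.
have [W [g' [oW cW hg' gg']]] := Ag _ e2.
exists (U `&` W), (a *: f' + g'); split.
- exact: openI.
- by move=> z cz; split; [exact: cU|exact: cW].
- move=> z [Uz Wz]; apply: differentiableD; last exact: hg'.
  by apply: differentiableZ; exact: hf'.
- move=> z Oz; rewrite [X in _ - X]/(_ + _) /=.
  rewrite opprD addrACA -mulrBr [leRHS]splitr (le_trans (ler_normD _ _)) //.
  rewrite lerD ?gg' // normrM.
  apply: (@le_trans _ _ ((`|a| + 1) * `|f z - f' z|)).
    by rewrite ler_wpM2r // lerDl.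
  by rewrite mulrC -ler_pdivlMr ?ff' // ltr_wpDl.
Qed.

Lemma A_alg_entire Omega f :
  holomorphic_on setT f -> A_alg Omega f.
Proof.
move=> hf e e0; exists setT, f; split=> //; first exact: openT.
by move=> z _; rewrite subrr normr0 ltW.
Qed.

Lemma A_tensor_linear Omega n (a : C) (F G : 'cV[C]_m -> 'cV[C]_n) :
  A_tensor Omega n F -> A_tensor Omega n G ->
  A_tensor Omega n (fun z => a *: F z + G z).
Proof.
move=> AF AG i; rewrite (_ : (fun z => _) = fun z => a * F z i 0 + G z i 0).
  exact: A_alg_linear.
by apply/funext => z; rewrite !mxE.
Qed.

End FunctionAlgebra.

Section Evaluation.
Context {R : realType} {m n : nat}.
Local Notation C := (Cplx R).
Context {Omega : set 'cV[C]_m} {H : hilbertSpace C}.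
Context {iota : ('cV[C]_m -> 'cV[C]_n) -> H}.
Hypothesis qf : quasi_free Omega iota.
Local Notation ev := (qf_eval Omega iota).

Lemma qf_eval_bounded_nr z : Omega z -> exists2 c : R, 0 <= c &
  forall F b, A_tensor Omega n F -> nr (F z b 0) <= c * nr (iota F).
Proof.
move=> Oz; have [c Hc] := qf_eval_bounded qf Oz.
exists (nr c) => [|F b AF]; first exact: nr_ge0.
have h := le_trans (nr_coord_l2norm (F z) b) (Hc _ AF).
rewrite -ler_Cplx nrE (le_trans h) // rmorphM /= !nrE.
have := le_trans (normr_ge0 _) h.
by move=> /ger0_norm <-; rewrite normrM normr_id.
Qed.

Lemma iota_approx (f : H) (e : R) : 0 < e ->
  exists2 F, A_tensor Omega n F & nr (iota F - f) < e.
Proof.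
move=> e0; have e0' : 0 < (e%:C : C) by rewrite ltr_Cplx.
have [|//|x [fx [F AF FE]]] := qf_iota_dense qf (O := ball f (e%:C)).
- by exists f; exact: ballxx.
- exact: ball_open.
exists F => //; rewrite FE nrBC -norm_lt_nr.
by move: fx; rewrite -ball_normE.
Qed.

Lemma iota_approx_seq (f : H) : exists F : nat -> 'cV[C]_m -> 'cV[C]_n,
  (forall j, A_tensor Omega n (F j)) /\ (fun j => iota (F j)) @ \oo --> f.
Proof.
have h (j : nat) : exists F, A_tensor Omega n F /\ nr (iota F - f) < j.+1%:R^-1.
  by have [|F] := @iota_approx f j.+1%:R^-1; [rewrite invr_gt0|exists F].
exists (fun j => projT1 (cid (h j))); split=> [j|].
  by have [] := projT2 (cid (h j)).
apply/cvg_nrP => e e0.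
have [N HN] := ex_natSinv_lt e0.
exists N => j Nj; have [_ hj] := projT2 (cid (h j)).
apply: lt_trans hj _; apply: le_lt_trans HN.
by rewrite lef_pV2 ?posrE // ler_nat.
Qed.

(** This makes [qf_eval] well posed: evaluation at [z] is bounded, so the values at [z] of two
    sequences with the same limit in [H] differ by a null sequence. *)
Lemma qf_eval_unique z F G (f : H) (w : 'cV[C]_n) : Omega z ->
  (forall j, A_tensor Omega n (F j)) -> (forall j, A_tensor Omega n (G j)) ->
  (fun j => iota (F j)) @ \oo --> f -> (fun j => iota (G j)) @ \oo --> f ->
  (fun j : nat => F j z) @ \oo --> w -> (fun j => G j z) @ \oo --> w.
Proof.
move=> Oz AF AG /cvg_nrP Ff /cvg_nrP Gf /cvg_nrP Fw; apply/cvg_nrP => e e0.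
have [c c0 Hc] := qf_eval_bounded_nr Oz.
(* The distances to [f] add up to less than [2 * d], and evaluation multiplies this by at most
   [c + 1], giving [e / 2]. The added 1 guards against [c = 0]. *)
pose d := e / 2 / (2 * (c + 1)).
have c1 : 0 < c + 1 by rewrite ltr_wpDl.
have d0 : 0 < d by rewrite !divr_gt0 // mulr_gt0.
have e2 : 0 < e / 2 by rewrite divr_gt0.
have [N1 h1] := Ff _ d0; have [N2 h2] := Gf _ d0; have [N3 h3] := Fw _ e2.
exists (maxn N1 (maxn N2 N3)) => j; rewrite !geq_max => /and3P[j1 j2 j3].
apply: le_lt_trans (nr_dist_triangle (F j z) _ _) _.
rewrite [ltRHS]splitr ltrD ?h3 //; apply: nr_mx_lt => // i.
have AFG := A_tensor_linear (-1) (AF j) (AG j).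
have := Hc _ i AFG; rewrite !mxE (qf_iota_linear qf) // scaleN1r => h.
rewrite mulN1r in h.
rewrite addrC (le_lt_trans h) // addrC.
have := nr_dist_triangle f (iota (G j)) (iota (F j)).
rewrite [nr (f - _)]nrBC => h4.
have {}h4 : nr (iota (G j) - iota (F j)) < 2 * d.
  by have := h1 _ j1; have := h2 _ j2; lra.
apply: (@le_lt_trans _ _ ((c + 1) * nr (iota (G j) - iota (F j)))).
  by rewrite ler_wpM2r ?nr_ge0 // lerDl.
rewrite mulrC -ltr_pdivlMr //; apply: lt_le_trans h4 _.
suff -> : 2 * d = e / 2 / (c + 1) by [].
by rewrite /d; field; rewrite gt_eqF.
Qed.

(** The choice in [qf_eval] is never a default value: boundedness of the evaluation makes each
    coordinate of [F j z] Cauchy, and by [qf_eval_unique] the limit serves all approximating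
    sequences. *)
Lemma qf_evalP z F (f : H) : Omega z ->
  (forall j, A_tensor Omega n (F j)) -> (fun j => iota (F j)) @ \oo --> f ->
  (fun j : nat => F j z) @ \oo --> ev f z.
Proof.
move=> Oz AF Ff.
suff [w Fw] : exists w : 'cV[C]_n, (fun j : nat => F j z) @ \oo --> w.
  rewrite /qf_eval; case: xgetP => [y _ /(_ F AF Ff) //|].
  move=> /(_ w) []; move=> G AG Gf; exact: (qf_eval_unique Oz AF AG Ff Gf Fw).
have [c c0 Hc] := qf_eval_bounded_nr Oz.
have hl i : exists l : C, (fun j : nat => F j z i 0) @ \oo --> l.
  apply: complete_complex => e e0.
  have c1 : 0 < c + 1 by rewrite ltr_wpDl.
  have /cauchy_nrP : cauchy ((fun j => iota (F j)) @ \oo).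
    by apply: cvg_cauchy; apply: cvgP Ff.
  move=> /(_ (e / (c + 1))) [|N HN]; first by rewrite divr_gt0.
  exists N => j k Nj Nk.
  have AFG := A_tensor_linear (-1) (AF k) (AF j).
  have := Hc _ i AFG; rewrite !mxE (qf_iota_linear qf) // scaleN1r mulN1r.
  rewrite addrC [in X in _ <= _ * X]addrC => h; apply: le_lt_trans h _.
  apply: (@le_lt_trans _ _ ((c + 1) * nr (iota (F j) - iota (F k)))).
    by rewrite ler_wpM2r ?nr_ge0 // lerDl.
  by rewrite mulrC -ltr_pdivlMr // HN.
exists (\col_i projT1 (cid (hl i))); apply/cvg_colP => i; rewrite mxE.
exact: projT2 (cid (hl i)).
Qed.

Lemma qf_eval_iota z F : Omega z -> A_tensor Omega n F -> ev (iota F) z = F z.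
Proof.
move=> Oz AF; have h := @qf_evalP z (fun=> F) (iota F) Oz (fun=> AF).
have {}h : (fun=> F z) @ \oo --> ev (iota F) z by apply: h; exact: cvg_cst.
have h' : (fun=> F z) @ \oo --> F z.
  by apply/cvg_nrP => e e0; exists 0%N => j _; rewrite subrr nr0.
exact: (@cvg_unique _ (@norm_hausdorff _ 'cV[C]_n) _ _ _ _ h h').
Qed.

Lemma qf_eval_linear z (a : C) (f g : H) : Omega z ->
  ev (a *: f + g) z = a *: ev f z + ev g z.
Proof.
move=> Oz.
have [F [AF Ff]] := iota_approx_seq f; have [G [AG Gg]] := iota_approx_seq g.
have h1 := qf_evalP Oz AF Ff; have h2 := qf_evalP Oz AG Gg.
have h3 : (fun j => a *: F j z + G j z) @ \oo --> ev (a *: f + g) z.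
  apply: (@qf_evalP z (fun j z => a *: F j z + G j z)) => // [j|].
    exact: A_tensor_linear.
  under [X in X @ _]eq_fun do rewrite (qf_iota_linear qf) //.
  exact: cvg_linear_comb.
have h4 : (fun j => a *: F j z + G j z) @ \oo --> a *: ev f z + ev g z.
  apply/cvg_colP => i; rewrite !mxE; move/cvg_colP: h1 => /(_ i) h1.
  move/cvg_colP: h2 => /(_ i) h2; under [X in X @ _]eq_fun do rewrite !mxE.
  exact: (@cvg_linear_comb _ C a _ _ _ _ h1 h2).
exact: (@cvg_unique _ (@norm_hausdorff _ 'cV[C]_n) _ _ _ _ h3 h4).
Qed.

Lemma qf_evalD z (f g : H) : Omega z -> ev (f + g) z = ev f z + ev g z.
Proof. by move=> Oz; rewrite -[f]scale1r qf_eval_linear // !scale1r. Qed.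

Lemma qf_eval0 z : Omega z -> ev 0 z = 0.
Proof.
by move=> Oz; apply: (@addrI _ (ev 0 z)); rewrite -qf_evalD // !addr0.
Qed.

Lemma qf_evalZ z (a : C) (f : H) : Omega z -> ev (a *: f) z = a *: ev f z.
Proof.
by move=> Oz; rewrite -[a *: f]addr0 qf_eval_linear // qf_eval0 // addr0.
Qed.

Lemma qf_eval_sum z (I : finType) (F : I -> H) : Omega z ->
  ev (\sum_i F i) z = \sum_i ev (F i) z.
Proof.
move=> Oz; apply: (big_morph (fun f => ev f z)) => [f g|].
  exact: qf_evalD.
exact: qf_eval0.
Qed.

(** Working with coordinates instead of the Euclidean norm changes the norm N(z) of the evaluation
    by at most a factor depending on [n], and suits matrix units, which act on single
    coordinates. *)
Definition eval_bound (z : 'cV[C]_m) (s : R) : Prop :=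
  forall f b, nr (ev f z b 0) <= s * nr f.

Lemma eval_bound_ex z : Omega z -> exists2 s, 0 < s & eval_bound z s.
Proof.
move=> Oz; have [c c0 Hc] := qf_eval_bounded_nr Oz.
exists (c + 1) => [|f b]; first by rewrite ltr_wpDl.
have [F [AF Ff]] := iota_approx_seq f.
have /cvg_colP /(_ b) h := qf_evalP Oz AF Ff.
apply/ler_addgt0Pr => e e0.
have c1 : 0 < c + 1 by rewrite ltr_wpDl.
apply: (nr_cvg_le h).
move/cvg_nrP: Ff => /(_ (e / (c + 1))) [|N HN]; first by rewrite divr_gt0.
exists N => j /HN; rewrite ltr_pdivlMr // => hj.
apply: le_trans (Hc _ b (AF j)) _.
have h1 : nr (iota (F j)) <= nr (iota (F j) - f) + nr f.
  by have := nr_triangle (iota (F j) - f) f; rewrite subrK.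
apply: (@le_trans _ _ ((c + 1) * nr (iota (F j)))).
  by rewrite ler_wpM2r ?nr_ge0 // lerDl.
apply: (@le_trans _ _ ((c + 1) * (nr (iota (F j) - f) + nr f))).
  by rewrite ler_pM2l.
by rewrite mulrDr addrC lerD2l mulrC ltW.
Qed.

End Evaluation.

(** * Evaluation norms blow up at the boundary *)

Section SupNorm.
Context {R : realType} {m : nat}.
Local Notation C := (Cplx R).

(* [supnorm] is a supremum for the partial order of C, with junk value 0 if
   there is none: its existence has to be imported from R. *)
Lemma supnorm_le (Omega : set 'cV[C]_m) (f : 'cV[C]_m -> C) (c : R) :
  Omega !=set0 -> (forall z, Omega z -> nr (f z) <= c) ->
  supnorm Omega f <= c%:C.
Proof.
move=> [z0 Oz0] fc; rewrite /supnorm /supremum.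
case: ifPn => [/eqP A0|_].
  suff : [set `|f z| | z in Omega] `|f z0| by rewrite A0.
  by exists z0.
pose A : set R := [set nr (f z) | z in Omega].
have supA : has_sup A.
  split; first by exists (nr (f z0)), z0.
  by exists c => _ [z Oz <-]; exact: fc.
case: xgetP => [y _ [_ ylb]|/(_ (sup A)%:C) []].
  by apply: ylb => _ [z Oz <-]; rewrite norm_le_nr; exact: fc.
split=> [_ [z Oz <-]|y yub].
  by rewrite norm_le_nr; apply: ub_le_sup; [exact: supA.2|exists z].
have y0 : 0 <= y by apply: le_trans (normr_ge0 _) (yub `|f z0| _); exists z0.
rewrite -[y](RRe_real (ger0_real y0)) ler_Cplx ge_sup // ?supA.1 //.
  exact: supA.1.
move=> _ [z Oz <-]; rewrite -norm_le_nr RRe_real ?ger0_real //.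
by apply: yub; exists z.
Qed.

End SupNorm.

(** * Peak functions at points of the sphere *)

Section Peak.
Context {R : realType} {m : nat}.
Local Notation C := (Cplx R).

Implicit Types w u : 'cV[C]_m.

Definition peak (w u : 'cV[C]_m) : C := 2^-1 * (1 + \sum_i (w i 0)^* * u i 0).

Lemma holomorphic_peakX w k : holomorphic_on setT (fun u => peak w u ^+ k).
Proof.
move=> z _.
suff h : differentiable (peak w) z.
  elim: k => [|k IH]; first exact: differentiable_cst.
  rewrite (_ : (fun u => _) = peak w * (fun u => peak w u ^+ k)).
    exact: differentiableM.
  by apply/funext => u; rewrite exprS.
rewrite (_ : peak w = cst 2^-1 * (cst 1 +
    \sum_i (cst (w i 0)^* * (fun u : 'cV[C]_m => u i 0)))); last first.
  by apply/funext => u; rewrite /peak -[RHS]/(_ * (_ + _)) fct_sumE.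
apply: differentiableM; first exact: differentiable_cst.
apply: differentiableD; first exact: differentiable_cst.
apply: differentiable_sum => i; apply: differentiableM.
  exact: differentiable_cst.
exact: differentiable_coord.
Qed.

Lemma peak_center w : \sum_i nr (w i 0) ^+ 2 = 1 -> peak w w = 1.
Proof.
move=> w1; rewrite /peak.
have -> : \sum_i (w i 0)^* * w i 0 = 1.
  rewrite -[RHS]/((1:R)%:C) -w1 rmorph_sum /=; apply: eq_bigr => i _.
  by rewrite rmorphXn /= nrE normCKC.
by rewrite -[1 + 1]/(2%:R) mulVf // pnatr_eq0.
Qed.

(** The termwise inequality ab <= (a^2 + b^2) / 2 takes the place of Cauchy-Schwarz: it gives |<u,
    w>| <= (1 + |u|^2) / 2 < 1. *)
Lemma nr_peak_lt1 w u : \sum_i nr (w i 0) ^+ 2 = 1 -> unit_ball m u ->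
  nr (peak w u) < 1.
Proof.
move=> w1; rewrite /unit_ball /= l2norm_lt1 => u1.
have h2 : nr (2^-1 : C) = 2^-1.
  by rewrite nrV /nr ger0_norm.
rewrite /peak nrM; set s := \sum_i _.
have hs : nr s <= \sum_i (nr (w i 0) ^+ 2 + nr (u i 0) ^+ 2) / 2.
  apply: le_trans (nr_sum _) _; apply: ler_sum => i _.
  rewrite nrM nr_conj; have := sqr_ge0 (nr (w i 0) - nr (u i 0)).
  by rewrite sqrrB; lra.
rewrite -mulr_suml big_split /= w1 in hs.
have h3 := nr_triangle (1 : C) s; rewrite nr1 in h3.
by rewrite h2; lra.
Qed.

End Peak.

Section Hilbert.
Context {R : realType} (H : hilbertSpace (Cplx R)).

Lemma parallelogram (x y : H) :
  nr (x + y) ^+ 2 + nr (x - y) ^+ 2 = 2 * nr x ^+ 2 + 2 * nr y ^+ 2.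
Proof.
have E (v : H) : (nr v ^+ 2)%:C = hilbert_dot H v v :> Cplx R.
  by rewrite rmorphXn /= nrE hilbert_normE.
apply: complexI; rewrite !mulr_natl !mulr2n !rmorphD /= !E.
rewrite linearB linearD /= !linearDl /= !linearNl.
by ring.
Qed.

End Hilbert.


Section BoundaryBlowUp.
Context {R : realType} {m n : nat}.
Local Notation C := (Cplx R).
Context {H : hilbertSpace C} {iota : ('cV[C]_m -> 'cV[C]_n) -> H}.
Local Notation Omega := (unit_ball (C := C) m).
Hypothesis qf : quasi_free Omega iota.
Hypothesis ctr : contractive Omega iota.

(** With the all-ones direction, a bound on any coordinate of the evaluation is a bound on [g]. *)
Definition vect (g : 'cV[C]_m -> C) : 'cV[C]_m -> 'cV[C]_n :=
  fun z => g z *: const_mx 1.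

Lemma vect_tensor g : holomorphic_on setT g -> A_tensor Omega n (vect g).
Proof.
move=> hg i; rewrite (_ : (fun z => _) = g); first exact: A_alg_entire.
by apply/funext => z; rewrite !mxE mulr1.
Qed.

Lemma unit_ball0 : Omega 0.
Proof.
rewrite /unit_ball /= l2norm_lt1 big1 // => i _.
by rewrite mxE nr0 expr0n.
Qed.

(** Let [g] act on the constant function [vect (fun=> 1)]: contractivity gives a bound that is the
    same for all such [g]. *)
Lemma iota_contractive g : holomorphic_on setT g ->
  (forall z, Omega z -> nr (g z) <= 1) ->
  nr (iota (vect g)) <= nr (iota (vect (fun=> 1))).
Proof.
move=> hg g1; rewrite -nr_le_normE.
have hcst : @holomorphic_on C m setT (cst 1).
  by move=> x _; exact: differentiable_cst.
have := ctr (A_alg_entire Omega hg) (vect_tensor hcst).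
rewrite (_ : (fun z => _) = vect g); last first.
  by apply/funext => z; rewrite /vect scale1r.
move=> h; apply: le_trans h _; rewrite mul1r -[leRHS]mul1r ler_wpM2r //.
by apply: (supnorm_le (c := 1)) => //; exists 0; exact: unit_ball0.
Qed.

(** A substitute for the convex hull of the powers of [peak w] with exponent at least [N]: it keeps
    the value 1 at [w] and the decay inside the ball, and is closed under midpoints. *)
Definition peaking (w : 'cV[C]_m) (N : nat) (g : 'cV[C]_m -> C) : Prop :=
  [/\ holomorphic_on setT g, g w = 1
    & forall u, Omega u -> nr (g u) <= nr (peak w u) ^+ N].

Section AtBoundaryPoint.
Context (w : 'cV[C]_m) (w1 : \sum_i nr (w i 0) ^+ 2 = 1).

Lemma peak_peaking N : peaking w N (fun u => peak w u ^+ N).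
Proof.
split=> [||u _]; first exact: holomorphic_peakX.
  by rewrite peak_center // expr1n.
by rewrite nrX.
Qed.

Lemma peaking_leq N M g : (N <= M)%N -> peaking w M g -> peaking w N g.
Proof.
move=> NM [hg gw gM]; split=> // u Ou; apply: le_trans (gM _ Ou) _.
apply: ler_wiXn2l => //; first exact: nr_ge0.
by rewrite ltW // nr_peak_lt1.
Qed.

Lemma peaking_midpoint N g h : peaking w N g -> peaking w N h ->
  peaking w N (fun u => 2^-1 * (g u + h u)).
Proof.
have h2 : nr (2^-1 : C) = 2^-1 by rewrite nrV /nr ger0_norm.
move=> [hg gw gN] [hh hw hN]; split=> [x _||u Ou].
- rewrite (_ : (fun u => _) = cst 2^-1 * (g + h)); last by apply/funext => u.
  apply: differentiableM; first exact: differentiable_cst.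
  by apply: differentiableD; [exact: hg|exact: hh].
- by rewrite gw hw -[1 + 1]/(2%:R) mulVf // pnatr_eq0.
- have := gN _ Ou; have := hN _ Ou.
  have : nr (g u + h u) <= nr (g u) + nr (h u) := nr_triangle _ _.
  by move: (nr (peak w u) ^+ N) => p; rewrite nrM h2; lra.
Qed.

Let sqN (g : 'cV[C]_m -> C) : R := nr (iota (vect g)) ^+ 2.
(** The squared distance from 0 to the image of [peaking w N] in [H]. *)
Let d N := inf [set sqN g | g in peaking w N].

Let d_le N g : peaking w N g -> d N <= sqN g.
Proof.
by move=> Ng; apply: ge_inf; [exists 0 => _ [h _ <-]; exact: sqr_ge0|exists g].
Qed.

Let d_approx N e : 0 < e -> exists2 g, peaking w N g & sqN g < d N + e.
Proof.
pose A := [set sqN g | g in peaking w N].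
move=> e0; have [|_ [g Ng <-] ge] := @inf_adherent _ A e e0.
  split.
    exists (sqN (fun u => peak w u ^+ N)), (fun u => peak w u ^+ N) => //.
    exact: peak_peaking.
  by exists 0 => _ [h _ <-]; exact: sqr_ge0.
by exists g.
Qed.

Let d_mono N M : (N <= M)%N -> d N <= d M.
Proof.
move=> NM; apply: lb_le_inf.
  exists (sqN (fun u => peak w u ^+ M)), (fun u => peak w u ^+ M) => //.
  exact: peak_peaking.
by move=> _ [g Mg <-]; apply: d_le; exact: peaking_leq Mg.
Qed.

(** Powers of the peak function are at most 1 on the ball, so [iota_contractive] bounds every [d N]
    by the squared norm of the constant function. An index at which [d] nearly attains its supremum
    serves as [N]. *)
Let d_cauchy e : 0 < e -> exists N, forall j, (N <= j)%N -> d j - d N < e.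
Proof.
move=> e0.
have supd : has_sup (range d).
  split; first by exists (d 0%N), 0%N.
  exists (sqN (fun=> 1)) => _ [N _ <-].
  apply: le_trans (d_le (peak_peaking N)) _.
  rewrite lerXn2r ?nnegrE ?nr_ge0 //; apply: iota_contractive.
    exact: holomorphic_peakX.
  move=> z Oz; rewrite nrX exprn_ile1 ?nr_ge0 // ltW // nr_peak_lt1 //.
have [_ [N _ <-] dN] := sup_adherent e0 supd.
exists N => j _; have : d j <= sup (range d).
  by apply: ub_le_sup; [exact: supd.2|exists j].
by move: dN; lra.
Qed.

(** The midpoint of [g] and [h] is again in [peaking w N], so their sum has squared norm at least
    [4 * d N]; the parallelogram law then bounds the difference. It is applied with [N <= M], where
    [d M - d N] is small. *)
Let peaking_dist N M g h e : peaking w N g -> peaking w N h ->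
  sqN g < d M + e -> sqN h < d M + e ->
  nr (iota (vect g) - iota (vect h)) ^+ 2 <= 4 * (d M - d N) + 4 * e.
Proof.
move=> Ng Nh gM hM; have [hg _ _] := Ng; have [hh _ _] := Nh.
have Nk := peaking_midpoint Ng Nh; have [hk _ _] := Nk.
have := d_le Nk; have := parallelogram (iota (vect g)) (iota (vect h)).
move: gM hM; rewrite /sqN; set k := (fun u => 2^-1 * _) in Nk hk *.
have -> : iota (vect g) + iota (vect h) = iota (vect k) + iota (vect k).
  have Tg := vect_tensor hg; have Th := vect_tensor hh; have Tk := vect_tensor hk.
  rewrite -[iota (vect g)]scale1r -[X in _ = X + _]scale1r.
  rewrite -!(qf_iota_linear qf) //; congr iota; apply/funext => z.
  rewrite !scale1r /vect -(scalerDl _ (g z)) -(scalerDl _ (k z)); congr (_ *: _).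
  by rewrite /k -[RHS]mulr2n -[RHS]mulr_natl mulrA divff ?mul1r ?pnatr_eq0.
have -> : nr (iota (vect k) + iota (vect k)) = 2 * nr (iota (vect k)).
  have h2 : nr (2%:R : C) = 2 by rewrite /nr ger0_norm.
  by rewrite -mulr2n -scaler_nat nrZ h2.
rewrite exprMn; lra.
Qed.

(* The sets [peaking w N] are convex and decrease with [N], so almost
   norm-minimal elements of them form a Cauchy sequence by the parallelogram
   law; it tends to 0 pointwise on the ball, hence in norm by [qf_cauchy]. *)
Lemma peaking_small (eta : R) : 0 < eta ->
  exists g, [/\ holomorphic_on setT g, g w = 1 & nr (iota (vect g)) < eta].
Proof.
move=> eta0.
have hex N : exists g, peaking w N g /\ sqN g < d N + N.+1%:R^-1.
  by have [|g Ng gd] := @d_approx N N.+1%:R^-1; [rewrite invr_gt0|exists g].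
pose g N := projT1 (cid (hex N)).
have gP N : peaking w N (g N) by have [] := projT2 (cid (hex N)).
have gd N : sqN (g N) < d N + N.+1%:R^-1 by have [] := projT2 (cid (hex N)).
have gT N : A_tensor Omega n (vect (g N)).
  by apply: vect_tensor; have [] := gP N.
have gC : cauchy ((fun N => iota (vect (g N))) @ \oo).
  apply/cauchy_nrP => e e0.
  (* [peaking_dist] multiplies two errors of this size by 4, for a total of [e ^+ 2 / 2]. *)
  have e8 : 0 < e ^+ 2 / 16 by rewrite divr_gt0 // exprn_gt0.
  have [N1 h1] := d_cauchy e8.
  have [N2 h2] := ex_natSinv_lt e8.
  pose N := maxn N1 N2; exists N => j k Nj Nk.
  wlog jk : j k Nj Nk / (j <= k)%N.
    move=> hw; have [|/ltnW] := leqP j k; first exact: hw.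
    by move=> kj; rewrite nrBC; exact: hw.
  have gdj : sqN (g j) < d k + N.+1%:R^-1.
    apply: lt_le_trans (gd j) _; rewrite lerD ?d_mono //.
    by rewrite lef_pV2 ?posrE // ler_nat.
  have gdk : sqN (g k) < d k + N.+1%:R^-1.
    apply: lt_le_trans (gd k) _; rewrite lerD2l //.
    by rewrite lef_pV2 ?posrE // ler_nat.
  have := peaking_dist (gP j) (peaking_leq jk (gP k)) gdj gdk.
  have h3 : N.+1%:R^-1 <= N2.+1%:R^-1 :> R.
    by rewrite lef_pV2 ?posrE // ler_nat ltnS leq_maxr.
  have h4 : d N1 <= d j by apply: d_mono; apply: leq_trans Nj; exact: leq_maxl.
  have h5 : d k - d N1 < e ^+ 2 / 16.
    by apply: h1; apply: leq_trans Nk; exact: leq_maxl.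
  move=> h6; have h7 : nr (iota (vect (g j)) - iota (vect (g k))) ^+ 2 < e ^+ 2.
    apply: le_lt_trans h6 _.
    have h8 := le_lt_trans h3 h2.
    have h9 : d k - d j < e ^+ 2 / 16 by apply: le_lt_trans h5; rewrite lerB.
    apply: (@lt_trans _ _ (4 * (e ^+ 2 / 16) + 4 * (e ^+ 2 / 16))).
      by rewrite ltrD // ltr_pM2l.
    by have := exprn_gt0 2 e0; lra.
  by rewrite -(@ltr_pXn2r _ 2) ?nnegrE ?nr_ge0 // ltW.
have g0 z : Omega z -> (fun j => vect (g j) z) @ \oo --> (0 : 'cV[C]_n).
  move=> Oz; apply/cvg_colP => i; apply/cvg_nrP => e e0.
  have hp : (fun j => nr (peak w z) ^+ j : R) @ \oo --> (0 : R).
    by apply: cvg_expr; rewrite ger0_norm ?nr_ge0 // nr_peak_lt1.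
  move/cvgrPdist_lt: hp => /(_ _ e0) [N _ HN]; exists N => j /HN /=.
  rewrite sub0r normrN ger0_norm ?exprn_ge0 ?nr_ge0 //.
  apply: le_lt_trans; rewrite !mxE mulr1 subr0.
  by have [_ _] := gP j; apply.
have [h _] := qf_cauchy qf gT gC.
have := h g0; move=> /(@cvg_nrP _ C) /(_ _ eta0) [N /(_ N (leqnn _)) hN].
exists (g N); have [hg gw _] := gP N; split=> //.
by move: hN; rewrite subr0 /nr normr_id.
Qed.

End AtBoundaryPoint.

(** Otherwise points approaching the sphere, with evaluation bounds below [S], cluster at some [w]
    of norm 1. A function with value 1 at [w] and small module norm is then larger at a nearby one
    of these points than its evaluation bound permits. *)
Lemma eval_bound_blow_up (n0 : (0 < n)%N) (S : R) : exists2 delta : R,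
  0 < delta < 1 & forall z (s : R), (1 - delta)%:C <= l2norm z < 1 ->
    eval_bound (Omega := Omega) (iota := iota) z s -> S <= s.
Proof.
apply: contrapT => Ncl.
(* The shift to [j.+2] keeps the excluded [delta] strictly below 1 even for [j = 0]. *)
have hz (j : nat) : exists z, exists s : R,
    [/\ (1 - j.+2%:R^-1)%:C <= l2norm z, l2norm z < 1,
      eval_bound (Omega := Omega) (iota := iota) z s & s < S].
  apply: contrapT => Nz; apply: Ncl; exists (j.+2%:R^-1).
    by rewrite invr_gt0 ltr0n invf_lt1 ?ltr1n ?ltr0n.
  move=> z s /andP[z1 z2] sz; rewrite leNgt; apply/negP => sS.
  by apply: Nz; exists z, s.
pose z j := projT1 (cid (hz j)).
have zP j := projT2 (cid (hz j)); rewrite -/(z _) in zP.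
pose q (v : 'cV[C]_m) := \sum_i nr (v i 0) ^+ 2.
have q_lt1 j : q (z j) < 1.
  by have [s [_ + _ _]] := zP j; rewrite l2norm_lt1.
have q_gt j : (1 - j.+2%:R^-1) ^+ 2 <= q (z j).
  have [s [+ _ _ _]] := zP j; rewrite l2normE ler_Cplx => h.
  have q0 : 0 <= q (z j) by rewrite sumr_ge0 // => i _; exact: sqr_ge0.
  rewrite -(sqr_sqrtr q0) lerXn2r ?nnegrE ?sqrtr_ge0 // subr_ge0.
  by rewrite invf_le1 ?ler1n ?ltr0n.
have z_le1 j i : nr (z j i 0) <= 1.
  rewrite -(@ler_pXn2r _ 2) ?nnegrE ?nr_ge0 // expr1n.
  apply: le_trans (ltW (q_lt1 j)); rewrite /q (bigD1 i) //= lerDl.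
  by rewrite sumr_ge0 // => k _; exact: sqr_ge0.
have [w wP] := bolzano_weierstrass_complex z_le1.
have w1 : q w = 1.
  apply/eqP; rewrite -subr_eq0 -normr_eq0; apply/eqP/le_anti.
  rewrite normr_ge0 andbT; apply/ler_addgt0Pr => e e0; rewrite add0r.
  (* Each coordinate changes the sum of squares by at most [3 * e1], as one modulus is at most 1 and
     the other at most 2; there are fewer than [m.+1] coordinates. *)
  pose e1 := Num.min 1 (e / 2 / (3 * m.+1%:R)).
  have e10 : 0 < e1 by rewrite lt_min ltr01 !divr_gt0 // mulr_gt0.
  have e4 : 0 < e / 4 by rewrite divr_gt0.
  have [N hN] := ex_natSinv_lt e4.
  have [j Nj hj] := wP _ N e10.
  have h1 : `|q w - q (z j)| <= e / 2.
    rewrite /q -sumrB; apply: le_trans (ler_norm_sum _ _ _) _.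
    apply: (@le_trans _ _ (\sum_(i < m) 3 * e1)).
      apply: ler_sum => i _.
      have a1 := z_le1 j i; have a2 := nr_ge0 (z j i 0).
      have a3 := nr_ge0 (w i 0); have a4 := hj i.
      have a5 := nr_triangle (w i 0) (z j i 0 - w i 0).
      have a6 := nr_triangle (z j i 0) (w i 0 - z j i 0).
      rewrite addrC subrK in a5; rewrite addrC subrK nrBC in a6.
      have a7 : e1 <= 1 by rewrite ge_min lexx.
      rewrite subr_sqr normrM.
      have b1 : `|nr (w i 0) - nr (z j i 0)| <= e1.
        by rewrite ler_norml; apply/andP; split; lra.
      have b2 : `|nr (w i 0) + nr (z j i 0)| <= 3.
        by rewrite ger0_norm ?addr_ge0 //; lra.
      by rewrite mulrC ler_pM.
    rewrite sumr_const card_ord -[leLHS]mulr_natr.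
    have : e1 <= e / 2 / (3 * m.+1%:R) by rewrite ge_min lexx orbT.
    rewrite ler_pdivlMr ?mulr_gt0 // => h; apply: le_trans h.
    by rewrite [3 * e1]mulrC -mulrA !ler_pM2l // ler_nat.
  (* Since (1 - t)^2 >= 1 - 2t, having t < e / 4 puts [q (z j)] within [e / 2] of 1. *)
  have h2 : j.+2%:R^-1 < e / 4 :> R.
    apply: le_lt_trans hN; rewrite lef_pV2 ?posrE // ler_nat.
    by rewrite ltnS (leq_trans Nj).
  have h3 := q_lt1 j; have h4 := q_gt j.
  have h5 : `|q (z j) - 1| <= e / 2.
    have h6 := sqr_ge0 (j.+2%:R^-1 : R).
    rewrite sqrrB expr1n mul1r in h4.
    move: (j.+2%:R^-1) h2 h4 h6 => t h2 h4 h6.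
    by rewrite ler_norml; apply/andP; split; lra.
  have := ler_normD (q w - q (z j)) (q (z j) - 1).
  by rewrite addrA subrK; lra.
(* With this [eta] the evaluation bound allows at most 1/2 at [z j], whereas continuity at [w]
   forces the modulus of [g (z j)] above 1/2. *)
pose eta := (2 * (`|S| + 1))^-1.
have S1 : 0 < `|S| + 1 by rewrite ltr_wpDl.
have eta0 : 0 < eta by rewrite invr_gt0 mulr_gt0.
have [g [hg gw geta]] := peaking_small w1 eta0.
have [e [e0 he]] : exists e : R, 0 < e /\
    forall u, nr (u - w) < e -> nr (g u - g w) < 2^-1.
  have /cvgrPdist_lt cg := differentiable_continuous (hg w I).
  have half0 : 0 < ((2^-1 : R)%:C : C) by rewrite ltr_Cplx.
  have /nbhs_ballP [e /gt0_complexP [e' e0 ->] he] := cg _ half0.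
  exists e'; split=> // u ue; rewrite nrBC -norm_lt_nr; apply: he.
  by rewrite -ball_normE /= norm_lt_nr nrBC.
have [j _ hj] := wP _ 0%N e0.
have {}hj : nr (z j - w) < e.
  by apply: nr_mx_lt => // i; rewrite !mxE.
have := he _ hj; rewrite gw => h1.
have [s [_ Oz sz sS]] := zP j.
have := sz (iota (vect g)) (Ordinal n0).
rewrite (qf_eval_iota qf) //; last exact: vect_tensor.
rewrite !mxE mulr1 => h2.
have h3 := nr_triangle (g (z j)) (1 - g (z j)).
rewrite addrC subrK nr1 [nr (1 - _)]nrBC in h3.
have h4 : s * nr (iota (vect g)) <= (`|S| + 1) * eta.
  apply: (@le_trans _ _ ((`|S| + 1) * nr (iota (vect g)))).
    rewrite ler_wpM2r ?nr_ge0 // (le_trans (ltW sS)) //.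
    by rewrite (le_trans (ler_norm _)) // lerDl.
  by rewrite ler_pM2l // ltW.
have h5 : (`|S| + 1) * eta = 2^-1.
  by rewrite /eta invfM mulrCA divff ?mulr1 // gt_eqF.
by lra.
Qed.

End BoundaryBlowUp.

(** * Semi-Fredholm tuples *)

Section BoundedOnBall.
Context {R : realType} {m n : nat}.
Local Notation C := (Cplx R).
Local Notation Omega := (unit_ball (C := C) m).

(** If [f] were unbounded along some sequence, that sequence would cluster in the closed ball, at a
    point where a holomorphic function within 1 of [f] is continuous. *)
Lemma A_alg_bounded (f : 'cV[C]_m -> C) : A_alg Omega f ->
  exists c : R, forall z, Omega z -> nr (f z) <= c.
Proof.
move=> Af; have [U [g [_ cU hg fg]]] := Af 1 ltr01.
apply: contrapT => /forallNP N.
have hz (j : nat) : exists z, Omega z /\ j%:R < nr (f z).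
  apply: contrapT => Nz; apply: (N j%:R) => z Oz.
  by rewrite leNgt; apply/negP => h; apply: Nz; exists z.
pose z j := projT1 (cid (hz j)).
have zO j : Omega (z j) by have [] := projT2 (cid (hz j)).
have zf j : j%:R < nr (f (z j)) by have [] := projT2 (cid (hz j)).
have z_le1 j i : nr (z j i 0) <= 1.
  rewrite -norm_le_nr; apply: le_trans (nr_coord_l2norm _ _) _.
  exact: ltW (zO j).
have [w wP] := bolzano_weierstrass_complex z_le1.
have cw : closure Omega w.
  move=> B /nbhs_ballP [e /gt0_complexP [e' e0 ->] eB].
  have [j _ hj] := wP _ 0%N e0; exists (z j); split=> //; apply: eB.
  rewrite -ball_normE /= norm_lt_nr nrBC; apply: nr_mx_lt => // i.
  by rewrite !mxE.
have /cvgrPdist_lt cg := differentiable_continuous (hg _ (cU _ cw)).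
have /nbhs_ballP [e /gt0_complexP [e' e0 ->] he] := cg _ ltr01.
pose b := Num.bound (nr (g w) + 2).
have [j Nj hj] := wP _ b e0.
have h1 : nr (g w - g (z j)) < 1.
  rewrite -norm_lt_nr; apply: he; rewrite -ball_normE /= norm_lt_nr nrBC.
  by apply: nr_mx_lt => // i; rewrite !mxE.
have h2 : nr (f (z j) - g (z j)) <= 1 by rewrite -norm_le_nr; exact: fg.
have h3 : nr (g w) + 2 < j%:R.
  apply: lt_le_trans (archi_boundP _) _; first by rewrite addr_ge0 ?nr_ge0.
  by rewrite ler_nat.
have h4 := nr_dist_triangle (g (z j)) (f (z j)) (g w).
have h5 := nr_triangle (f (z j) - g w) (g w); rewrite subrK in h5.
rewrite [nr (g (z j) - _)]nrBC in h4.
by have := zf j; lra.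
Qed.

Lemma A_tensor_bounded (F : 'cV[C]_m -> 'cV[C]_n) : A_tensor Omega n F ->
  exists c : R, forall z i, Omega z -> nr (F z i 0) <= c.
Proof.
move=> AF; have h i := cid (A_alg_bounded (AF i)).
exists (\sum_i `|projT1 (h i)|) => z i Oz.
apply: le_trans (projT2 (h i) z Oz) _; apply: le_trans (ler_norm _) _.
by rewrite (bigD1 i) //= lerDl sumr_ge0.
Qed.

End BoundedOnBall.

Section Multipliers.
Context {R : realType} {m n : nat}.
Local Notation C := (Cplx R).
Context {Omega : set 'cV[C]_m} {H : hilbertSpace C}.
Context {iota : ('cV[C]_m -> 'cV[C]_n) -> H}.
Hypothesis qf : quasi_free Omega iota.
Hypothesis mult : multiplier_space Omega iota = Hinf_mx Omega n.
Local Notation ev := (qf_eval Omega iota).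

Lemma mult_opP phi f z : Hinf_mx Omega n phi -> Omega z ->
  ev (mult_op Omega iota phi f) z = phi z *m ev f z.
Proof.
rewrite -mult => -[T [_ Tphi]] Oz.
rewrite /mult_op; case: xgetP => [y _ /(_ z Oz) //|/(_ (T f)) []].
by move=> u; exact: Tphi.
Qed.

(** Constant matrices are bounded and holomorphic, hence multipliers by [mult], and the continuity
    of the operator supplies its norm bound. *)
Lemma constant_multiplier (A : 'M[C]_n) : exists (T : H -> H) (c : R),
  (forall f, nr (T f) <= c * nr f) /\
  forall f z, Omega z -> ev (T f) z = A *m ev f z.
Proof.
have : Hinf_mx Omega n (fun=> A).
  move=> i j; split; first by move=> z _; exact: differentiable_cst.
  by exists `|A i j|.
rewrite -mult => -[T [cT TA]]; exists T.
have /linear_boundedP/pinfty_ex_gt0 [c c0 Tc] :=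
  (linear_bounded_continuous T).2 cT.
have [c' c'0 cE] := gt0_complexP c0.
exists c'; split=> // f; rewrite -ler_Cplx rmorphM /= !nrE -cE; exact: Tc.
Qed.

Lemma matrix_units_bounded : exists2 B : R, 0 < B & forall a b : 'I_n,
  exists T : H -> H, (forall f, nr (T f) <= B * nr f) /\
    forall f z, Omega z -> ev (T f) z = delta_mx a b *m ev f z.
Proof.
pose T a b := cid (constant_multiplier (delta_mx a b)).
pose c a b := cid (projT2 (T a b)).
exists (1 + \sum_a \sum_b `|projT1 (c a b)|) => [|a b].
  by rewrite ltr_wpDr // sumr_ge0 // => a _; rewrite sumr_ge0.
exists (projT1 (T a b)); have [h1 h2] := projT2 (c a b); split=> // f.
apply: le_trans (h1 f) _; rewrite ler_wpM2r ?nr_ge0 //.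
apply: le_trans (ler_norm _) _; rewrite ler_wpDl //.
rewrite (bigD1 a) //= ler_wpDr // ?sumr_ge0 //.
  by move=> i _; rewrite sumr_ge0.
by rewrite (bigD1 b) //= lerDl sumr_ge0.
Qed.

(** Such an [s] is within a factor 2 of the least evaluation bound. Halving a given bound must stop,
    because the all-ones constant function has value 1 at [z]. *)
Lemma eval_bound_critical z : (0 < n)%N -> Omega z -> exists2 s : R, 0 < s &
  eval_bound (Omega := Omega) (iota := iota) z s /\
  ~ eval_bound (Omega := Omega) (iota := iota) z (s / 2).
Proof.
move=> n0 Oz; have [s s0 sz] := eval_bound_ex qf Oz.
apply: contrapT => N.
have hk (k : nat) : eval_bound (Omega := Omega) (iota := iota) z (s / 2 ^+ k).
  elim: k => [|k IH]; first by rewrite expr0 divr1.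
  rewrite exprSr invfM mulrA; apply: contrapT => Nk; apply: N.
  by exists (s / 2 ^+ k) => //; rewrite divr_gt0 // exprn_gt0.
have A1 : A_tensor Omega n (fun=> const_mx 1).
  move=> i; apply: A_alg_entire => x _.
  rewrite (_ : (fun=> _) = cst 1); first exact: differentiable_cst.
  by apply/funext => u; rewrite mxE.
pose N1 := nr (iota (fun=> const_mx 1)).
pose k := Num.bound (s * N1).
have := hk k (iota (fun=> const_mx 1)) (Ordinal n0).
rewrite qf_eval_iota // mxE nr1 mulrAC ler_pdivlMr ?exprn_gt0 // mul1r.
apply/negP; rewrite -ltNge.
apply: lt_le_trans (archi_boundP _) _; first by rewrite mulr_ge0 ?nr_ge0 // ltW.
by rewrite -natrX ler_nat ltnW // ltn_expl.
Qed.

End Multipliers.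

(** * Uniform boundedness applied to a semi-Fredholm tuple *)

Section SemiFredholmTuple.
Context {R : realType} {m n k : nat}.
Local Notation C := (Cplx R).
Context {Omega : set 'cV[C]_m} {H : hilbertSpace C}.
Context {iota : ('cV[C]_m -> 'cV[C]_n) -> H}.
Context {phi : 'I_k -> 'cV[C]_m -> 'M[C]_n}.
Hypothesis qf : quasi_free Omega iota.
Hypothesis mult : multiplier_space Omega iota = Hinf_mx Omega n.
Hypothesis phi_Hinf : forall i, Hinf_mx Omega n (phi i).
Local Notation ev := (qf_eval Omega iota).
Local Notation eval_bound := (eval_bound (Omega := Omega) (iota := iota)).

Lemma nr_dot_le (x y : 'cV[C]_n) (c : R) : (forall a, nr (y a 0) <= c) ->
  nr ((x ^t* *m y) 0 0) <= (\sum_a nr (x a 0)) * c.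
Proof.
move=> yc; rewrite mxE mulr_suml; apply: le_trans (nr_sum _) _.
apply: ler_sum => a _; rewrite nrM !mxE nr_conj.
by rewrite ler_wpM2l ?nr_ge0.
Qed.

Context {d : nat} {v : 'I_d -> H}.
Hypothesis phi_codim : forall h, exists c : 'I_d -> C,
  row_range (fun i => mult_op Omega iota (phi i)) (h - \sum_j c j *: v j).

(* Each test yields the functional f |-> <f(z), x> / (t s), where [s] bounds the
   evaluation at [z] and [t], [s] are such that the tuple and the defect vectors
   [v j] contribute at most 1 per unit of norm or coefficient. *)
Record test := Test {
  test_pt : 'cV[C]_m;
  test_dir : 'cV[C]_n;
  test_tol : R;
  test_scale : R;
  test_in : Omega test_pt;
  test_scale_gt0 : 0 < test_scale;
  test_bound : eval_bound test_pt test_scale;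
  test_tol_gt0 : 0 < test_tol;
  test_phi : forall i l,
    nr ((test_dir ^t* *m phi i test_pt) 0 l) <= test_tol;
  test_defect : forall j,
    nr ((test_dir ^t* *m ev (v j) test_pt) 0 0) <= test_tol * test_scale
}.

Let L (q : test) (f : H) : C :=
  (test_tol q * test_scale q)^-1%:C *
  ((test_dir q) ^t* *m ev f (test_pt q)) 0 0.

Let nrL q f : nr (L q f) =
  nr (((test_dir q) ^t* *m ev f (test_pt q)) 0 0) /
  (test_tol q * test_scale q).
Proof.
rewrite /L nrM nr_real mulrC ger0_norm // invr_ge0 ltW //.
by rewrite mulr_gt0 ?test_tol_gt0 ?test_scale_gt0.
Qed.

(** Pointwise boundedness of the family [L] is where finite codimension enters. For a decomposition
    of [h], the range part is controlled by [test_phi] and [test_bound], the rest by [test_defect],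
    with constants independent of the test. *)
Lemma tests_uniformly_bounded : exists2 K : R, 0 < K & forall (q : test) f,
  nr (((test_dir q) ^t* *m ev f (test_pt q)) 0 0) <=
    K * (test_tol q * test_scale q) * nr f.
Proof.
have ts0 q : 0 < test_tol q * test_scale q.
  by rewrite mulr_gt0 ?test_tol_gt0 ?test_scale_gt0.
have [||||c Lc] := @uniform_boundedness _ H _ L.
- move=> q f g; rewrite /L qf_evalD //; last exact: test_in.
  by rewrite mulmxDr mxE mulrDr.
- move=> q a f; rewrite /L qf_evalZ //; last exact: test_in.
  by rewrite -scalemxAr mxE mulrCA.
- move=> q; exists ((\sum_a nr (test_dir q a 0)) * test_scale q /
    (test_tol q * test_scale q)) => f.
  rewrite nrL mulrAC ler_pM2r ?invr_gt0 // -mulrA.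
  by apply: nr_dot_le => a; exact: test_bound.
- move=> h; have [c [g _ gE]] := phi_codim h.
  exists ((\sum_i \sum_(l < n) nr (g i)) + \sum_j nr (c j)) => q.
  rewrite nrL ler_pdivrMr //.
  have -> : h = \sum_i mult_op Omega iota (phi i) (g i) + \sum_j c j *: v j.
    by rewrite gE subrK.
  have Oq := test_in q.
  rewrite qf_evalD // !qf_eval_sum // mulmxDr mxE.
  apply: le_trans (nr_triangle _ _) _; rewrite mulrDl lerD //.
    rewrite mulmx_sumr summxE; apply: le_trans (nr_sum _) _.
    rewrite mulr_suml; apply: ler_sum => i _.
    rewrite (mult_opP mult) // mulmxA mxE; apply: le_trans (nr_sum _) _.
    rewrite mulr_suml; apply: ler_sum => l _.
    rewrite nrM [leRHS]mulrCA.
    apply: ler_pM; rewrite ?nr_ge0 ?test_phi //.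
    by rewrite mulrC; exact: test_bound.
  rewrite mulmx_sumr summxE; apply: le_trans (nr_sum _) _.
  rewrite mulr_suml; apply: ler_sum => j _.
  rewrite qf_evalZ // -scalemxAr mxE nrM ler_wpM2l ?nr_ge0 //.
  exact: test_defect.
exists (`|c| + 1) => [|q f]; first by rewrite ltr_wpDl.
have := Lc q f; rewrite nrL ler_pdivrMr // => h.
apply: le_trans h _; rewrite mulrAC ler_wpM2r ?nr_ge0 //.
by rewrite ler_wpM2r ?(ltW (ts0 q)) // ler_wpDr // ler_norm.
Qed.

(* Matrix units are bounded multipliers and move the estimate from the direction
   [x] to every coordinate; if [x] were large compared with [t], [s / 2] would
   bound the evaluation at [z]. *)
Lemma test_dir_le : exists2 K : R, 0 < K & forall q : test,
  ~ eval_bound (test_pt q) (test_scale q / 2) ->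
  forall a, nr (test_dir q a 0) <= K * test_tol q.
Proof.
have [K K0 HK] := tests_uniformly_bounded.
have [B B0 HB] := matrix_units_bounded mult.
(* The factor 2 makes the estimate for [T f] come out with the scale halved. *)
exists (2 * K * B) => [|q Nq a]; first by rewrite !mulr_gt0.
have t0 := test_tol_gt0 q; have s0 := test_scale_gt0 q; have Oq := test_in q.
rewrite leNgt; apply/negP => xa; apply: Nq => f b.
have [T [TB Tev]] := HB a b.
have x0 : 0 < nr (test_dir q a 0).
  by apply: lt_trans xa; rewrite !mulr_gt0.
have := HK q (T f); rewrite Tev //.
have -> : ((test_dir q) ^t* *m (delta_mx a b *m ev f (test_pt q))) 0 0 =
    (test_dir q a 0)^* * ev f (test_pt q) b 0.
  rewrite mxE (bigD1 a) //= big1 ?addr0 => [|i ia]; last first.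
    rewrite [X in _ * X]mxE big1 ?mulr0 // => l _.
    by rewrite mxE (negPf ia) mul0r.
  rewrite !mxE (bigD1 b) //= big1 ?addr0 => [|l lb]; last first.
    by rewrite mxE (negPf lb) andbF mul0r.
  by rewrite mxE !eqxx mul1r.
rewrite nrM nr_conj => h1.
rewrite -(ler_pM2l x0); apply: le_trans h1 _.
apply: (@le_trans _ _ (K * (test_tol q * test_scale q) * (B * nr f))).
  by rewrite ler_wpM2l // ltW // !mulr_gt0.
rewrite mulrA [leRHS]mulrA ler_wpM2r ?nr_ge0 //.
apply: (@le_trans _ _ (2 * K * B * test_tol q * (test_scale q / 2))).
  by rewrite le_eqVlt; apply/orP; left; apply/eqP; field.
by rewrite ler_wpM2r // ltW // divr_gt0.
Qed.

End SemiFredholmTuple.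

(** * From norms of rows to the Loewner order *)

Section Loewner.
Context {R : realType} {n k : nat}.
Local Notation C := (Cplx R).

(** The quadratic form of each summand at [x] is the squared Euclidean norm of the row obtained by
    applying the adjoint of [x] to [A i], so the Loewner inequality reduces to one in [R]. *)
Lemma mx_ge_sumP (A : 'I_k -> 'M[C]_n) (eps : R) :
  (forall x : 'cV[C]_n, eps * \sum_a nr (x a 0) ^+ 2 <=
    \sum_i \sum_l nr ((x ^t* *m A i) 0 l) ^+ 2) ->
  mx_ge (\sum_i A i *m (A i) ^t*) (eps%:C)%:M.
Proof.
move=> H x; rewrite mulmxBr mulmxBl mulmx_sumr mulmx_suml.
have entryB (P Q : 'M[C]_1) : (P - Q) 0 0 = P 0 0 - Q 0 0 by rewrite !mxE.
rewrite entryB subr_ge0 summxE.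
rewrite scalar_mxC mul_scalar_mx -scalemxAl [X in X <= _]mxE.
have -> : (x^t* *m x) 0 0 = (\sum_a nr (x a 0) ^+ 2)%:C.
  rewrite mxE rmorph_sum /=; apply: eq_bigr => a _.
  by rewrite rmorphXn /= nrE normCKC !mxE.
have -> : \sum_i (x^t* *m (A i *m (A i)^t*) *m x) 0 0 =
    (\sum_i \sum_l nr ((x ^t* *m A i) 0 l) ^+ 2)%:C.
  rewrite rmorph_sum /=; apply: eq_bigr => i _.
  have -> : x^t* *m (A i *m (A i)^t*) *m x = (x^t* *m A i) *m (x^t* *m A i)^t*.
    have xx : x ^t* ^t* = x by apply/matrixP => a b; rewrite !mxE conjCK.
    by rewrite trmx_mul map_mxM xx !mulmxA.
  rewrite mxE rmorph_sum /=; apply: eq_bigr => l _.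
  by rewrite rmorphXn /= nrE normCK [in RHS]mulrC mulrC !mxE.
by rewrite -rmorphM ler_Cplx.
Qed.

End Loewner.

Theorem proposition1 (R : realType) (m n k : nat)
    (H : hilbertSpace (Cplx R))
    (iota : ('cV[Cplx R]_m -> 'cV[Cplx R]_n) -> H)
    (phi : 'I_k -> 'cV[Cplx R]_m -> 'M[Cplx R]_n)
    (m_ge1 : (1 <= m)%N) (n_ge1 : (1 <= n)%N)
    (H_quasi_free : quasi_free (unit_ball m) iota)
    (H_contractive : contractive (unit_ball m) iota)
    (H_multipliers :
      multiplier_space (unit_ball m) iota = Hinf_mx (unit_ball m) n)
    (phi_Hinf : forall i, Hinf_mx (unit_ball m) n (phi i))
    (phi_semi_fredholm :
      semi_fredholm (fun i => mult_op (unit_ball m) iota (phi i))) :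
  exists eps delta : R, [/\ 0 < eps, 0 < delta < 1,
    forall z : 'cV[Cplx R]_m, (1 - delta)%:C <= l2norm z < 1 ->
      mx_ge (\sum_i phi i z *m (phi i z) ^t*) (eps%:C)%:M
  & n = 1%N -> forall (j : 'I_n) (z : 'cV[Cplx R]_m),
      (1 - delta)%:C <= l2norm z < 1 ->
      eps%:C <= \sum_i `|phi i z j j| ^+ 2].
Proof.
suff [eps [delta [eps0 d01 Hge]]] : exists eps delta : R,
    [/\ 0 < eps, 0 < delta < 1 &
    forall z : 'cV[Cplx R]_m, (1 - delta)%:C <= l2norm z < 1 ->
      mx_ge (\sum_i phi i z *m (phi i z) ^t*) (eps%:C)%:M].
  (* In rank one, the Loewner inequality is tested on the vector [1%:M]. *)
  exists eps, delta; split=> // n1; subst n => j z /Hge /(_ 1%:M).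
  rewrite [j]ord1 trmx1 map_mx1 mul1mx mulmx1 !mxE mulr1n subr_ge0 summxE.
  congr (_ <= _); apply: eq_bigr => i _.
  by rewrite mxE big_ord1 !mxE normCK.
have [d [v phi_codim]] := phi_semi_fredholm.
have [K K0 HK] := test_dir_le H_quasi_free H_multipliers phi_Hinf phi_codim.
pose N : R := n%:R; have N0 : 0 < N by rewrite ltr0n.
(* A defect vector [v j] is split into a bounded function [F j] and an error of norm below [eta]. At
   [z] they contribute at most [M] and [s * eta]; each is at most [s / (4 * K * N)] once [s] passes
   the threshold [4 * K * N * M]. *)
pose eta := (4 * K * N)^-1.
have eta0 : 0 < eta by rewrite invr_gt0 !mulr_gt0.
have hF j := cid2 (iota_approx H_quasi_free (v j) eta0).
pose F j := projT1 (hF j).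
have FA j : A_tensor (unit_ball m) n (F j) by have [] := projT2 (hF j).
have Fv j : nr (iota (F j) - v j) < eta by have [] := projT2 (hF j).
have hM j := cid (A_tensor_bounded (FA j)).
pose M := \sum_j `|projT1 (hM j)|.
have FM j z b : unit_ball m z -> nr (F j z b 0) <= M.
  move=> Oz; apply: le_trans (projT2 (hM j) z b Oz) _.
  apply: le_trans (ler_norm _) _.
  by rewrite /M (bigD1 j) //= lerDl sumr_ge0.
have [delta d01 Hdelta] :=
  eval_bound_blow_up H_quasi_free H_contractive n_ge1 (4 * K * N * M).
(* Chosen so that [eps * (N * X ^+ 2)] is the square of the tolerance [X / (2 * K)] used below. *)
pose eps := (4 * K ^+ 2 * N)^-1.
have eps0 : 0 < eps by rewrite invr_gt0 !mulr_gt0 // exprn_gt0.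
exists eps, delta; split=> // z z1; apply: mx_ge_sumP => x.
have /andP[_ Oz] := z1.
have [s s0 [sz sNz]] := eval_bound_critical H_quasi_free n_ge1 Oz.
have sM := Hdelta z s z1 sz.
pose X := \big[Num.max/0]_a nr (x a 0).
have xX a : nr (x a 0) <= X by exact: le_bigmax.
have X_ge0 : 0 <= X by exact: le_trans (nr_ge0 _) (xX (Ordinal n_ge1)).
have lhs_le : eps * \sum_a nr (x a 0) ^+ 2 <= (X / (2 * K)) ^+ 2.
  apply: (@le_trans _ _ (eps * (N * X ^+ 2))).
    rewrite ler_pM2l // /N -[n in n%:R]card_ord mulr_natl -sumr_const.
    by apply: ler_sum => a _; rewrite lerXn2r ?nnegrE ?nr_ge0.
  rewrite le_eqVlt; apply/orP; left; apply/eqP; rewrite /eps; field.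
  by rewrite !gt_eqF.
apply: le_trans lhs_le _.
have [X0|X0] := eqVneq X 0.
  rewrite X0 mul0r expr0n /=; apply: sumr_ge0 => i _; apply: sumr_ge0 => l _.
  exact: sqr_ge0.
have Xgt0 : 0 < X by rewrite lt0r X0.
(* Either some entry of a row exceeds [t], which already gives the bound, or [x] with tolerance [t]
   is a valid test. In the latter case [test_dir_le] yields [X <= K * t], that is [X <= X / 2],
   which is absurd. *)
pose t := X / (2 * K).
have t0 : 0 < t by rewrite divr_gt0 // mulr_gt0.
have [/existsP[i /existsP[l tl]]|small] :=
    boolP [exists i, exists l, t < nr ((x^t* *m phi i z) 0 l)].
  apply: (@le_trans _ _ (nr ((x^t* *m phi i z) 0 l) ^+ 2)).
    by rewrite lerXn2r ?nnegrE ?nr_ge0 // ltW.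
  rewrite (bigD1 i) //= (bigD1 l) //= -addrA lerDl addr_ge0 ?sumr_ge0 //.
    by move=> *; exact: sqr_ge0.
  by move=> *; apply: sumr_ge0 => *; exact: sqr_ge0.
have {}small i l : nr ((x^t* *m phi i z) 0 l) <= t.
  rewrite leNgt; apply: contra small => h.
  by apply/existsP; exists i; apply/existsP; exists l.
have defect j :
    nr ((x^t* *m qf_eval (unit_ball m) iota (v j) z) 0 0) <= t * s.
  apply: (@le_trans _ _ ((\sum_a nr (x a 0)) * (M + s * eta))).
    apply: nr_dot_le => a.
    have -> : v j = -1 *: (iota (F j) - v j) + iota (F j).
      by rewrite scaleN1r opprB subrK.
    rewrite (qf_eval_linear H_quasi_free) // (qf_eval_iota H_quasi_free) //.
    rewrite mxE mxE mulN1r; apply: le_trans (nr_triangle _ _) _.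
    rewrite [leRHS]addrC lerD ?FM // nrN; apply: le_trans (sz _ _) _.
    by rewrite ler_pM2l // ltW.
  apply: (@le_trans _ _ (N * X * (s / (2 * K * N)))).
    apply: ler_pM.
    - by apply: sumr_ge0 => a _; exact: nr_ge0.
    - by rewrite addr_ge0 ?sumr_ge0 // mulr_ge0 // ltW.
    - rewrite /N -[n in n%:R]card_ord mulr_natl -sumr_const.
      by apply: ler_sum.
    - have hM' : M <= s / (4 * K * N).
        by rewrite ler_pdivlMr ?mulr_gt0 // mulrC.
      have -> : s / (2 * K * N) = s / (4 * K * N) + s * eta.
        by rewrite /eta; field; rewrite !gt_eqF.
      by rewrite lerD2r.
  rewrite le_eqVlt; apply/orP; left; apply/eqP; rewrite /t; field.
  by rewrite !gt_eqF.
pose q := @Test R m n k (unit_ball m) H iota phi d v z x t s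
  Oz s0 sz t0 small defect.
have := HK q sNz => /= hx.
suff : X <= K * t.
  have -> : K * t = X / 2 by rewrite /t; field; rewrite gt_eqF.
  by rewrite leNgt ltr_pdivrMr // mulr_natr mulr2n ltrDl Xgt0.
by apply/bigmax_leP; split=> [|a _]; [rewrite mulr_ge0 // ltW|exact: hx].
Qed.
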